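(* The set $$\{S\in \mathcal{X}: \text{ there does not exist an interval exchange transformation } T \text{ with } S \text{ isomorphic to } T\}$$ contains a dense $G_\delta$ subset of $\mathcal{X}$ (with respect to the weak topology on $\mathcal{X}$).
   Context: $\lambda$ denotes Lebesgue measure. $\mathcal{X}$ is the set of all bimeasurable (i.e. invertible, measurable with measurable inverse) transformations $T:[0,1]\to[0,1]$ that preserve $\lambda$, modulo the equivalence relation $T\sim S$ iff $Tx=Sx$ for $\lambda$-almost every $x$. The weak topology on $\mathcal{X}$ is the topology generated by the sets $N(T,A,\epsilon)=\{S\in\mathcal{X}: \lambda(SA\,\Delta\, TA)<\epsilon\}$, where $T\in\mathcal{X}$, $A\subset[0,1)$ is measurable and $\epsilon>0$; it makes $\mathcal{X}$ a Polish space. An interval exchange transformation (IET) is an invertible piecewise orientation-preserving isometry $T$ of the interval $[0,1)$, such that $[0,1)$ is divided into finitely many ($d$) left-closed, right-open subintervals that are permuted by $T$. It is regarded as a measure-preserving system with respect to $\lambda$. Two measure-preserving systems $(X,\mathcal{M},\mu,T)$ and $(Y,\mathcal{N},\nu,S)$ are isomorphic if there exist $\phi:X\to Y$, defined $\mu$-almost everywhere, and $\phi^{-1}:Y\to X$, defined $\nu$-almost everywhere, (measurable and mutually inverse almost everywhere) so that $\phi_*\mu=\nu$ and $S=\phi\circ T\circ\phi^{-1}$ almost everywhere. *)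

(* Defs.v *)
From HB Require Import structures.
From mathcomp Require Import all_boot all_order all_algebra.
From mathcomp Require Import all_classical all_reals all_analysis.

Set Implicit Arguments.
Unset Strict Implicit.
Unset Printing Implicit Defensive.

Import Order.TTheory GRing.Theory Num.Theory.
Import numFieldNormedType.Exports.

Local Open Scope classical_set_scope.
Local Open Scope ring_scope.

(* Lebesgue measure on the interval [i], as a measure on [R] that is
   concentrated on [i]: transformations of [i] are represented by functions
   [R -> R], whose values outside [i] are irrelevant. Measurable means Borel
   measurable throughout; since Lebesgue automorphisms and isomorphisms agree
   a.e. with Borel ones, this changes neither the space [autom] below nor the
   isomorphism relation. *)
Definition leb_on (R : realType) (i : interval R) :
    set (measurableTypeR R) -> \bar R :=
  mrestr lebesgue_measure (measurable_itv i).

HB.instance Definition _ (R : realType) (i : interval R) :=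
  Measure.on (@leb_on R i).

Definition is_autom (R : realType) (T : R -> R) : Prop :=
  let I : set R := [set` `[0, 1]] in
  [/\ exists T' : R -> R,
        [/\ set_fun I I T, set_fun I I T',
            (forall x, I x -> T' (T x) = x) /\ (forall x, I x -> T (T' x) = x),
            measurable_fun I T & measurable_fun I T'] &
      forall A : set R, measurable A ->
        pushforward (leb_on `[0, 1]) T A = leb_on `[0, 1] A].

Record preautom (R : realType) := Preautom {
  preautom_fun :> R -> R;
  preautomP : is_autom preautom_fun }.

HB.instance Definition _ (R : realType) := gen_eqMixin (preautom R).
HB.instance Definition _ (R : realType) := gen_choiceMixin (preautom R).

Section autom.
Variable R : realType.
Implicit Types S T : preautom R.

Definition preautom_eq S T : bool :=
  `[< (S : R -> R) = T %[ae leb_on `[0, 1]] >].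

Let preautom_eq_refl : reflexive preautom_eq.
Proof. by move=> T; apply/asboolP/aeW. Qed.

Let preautom_eq_sym : symmetric preautom_eq.
Proof.
have aeS := @filterS _ _ (ae_filter_ringOfSetsType (leb_on `[0 : R, 1])).
by move=> S T; apply/asboolP/asboolP; apply: aeS => x /= /(_ I) ->.
Qed.

Let preautom_eq_trans : transitive preautom_eq.
Proof.
have aeS := @filterS2 _ _ (ae_filter_ringOfSetsType (leb_on `[0 : R, 1])).
move=> S T U /asboolP TS /asboolP SU; apply/asboolP.
by apply: aeS TS SU => x /= /(_ I) -> /(_ I).
Qed.

Canonical preautom_eq_canonical :=
  EquivRel preautom_eq preautom_eq_refl preautom_eq_sym preautom_eq_trans.

Local Open Scope quotient_scope.

Definition autom : Type := {eq_quot preautom_eq}.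
HB.instance Definition _ := Choice.on autom.
HB.instance Definition _ := EqQuotient.on autom.

(* The notions below applied to this representative do not depend on it: they
   are invariant under a.e. modifications of the transformation. *)
Definition autom_fun (T : autom) : R -> R := repr T.

Definition weak_nbhs (T : autom) (A : set R) (e : R) : set autom :=
  [set S | (lebesgue_measure
              ((autom_fun S @` A) `+` (autom_fun T @` A)) < e%:E)%E].

Definition weak_subbase : set (set autom) :=
  [set N | exists (T : autom) (A : set R) (e : R),
     [/\ measurable A, A `<=` [set` `[0, 1[], 0 < e & N = weak_nbhs T A e]].

HB.instance Definition _ :=
  isSubBaseTopological.Build autom weak_subbase id.

End autom.

Definition is_iet (R : realType) (T : R -> R) : Prop :=
  set_bij [set` `[0, 1[] [set` `[0, 1[] T /\
  exists2 s : seq R, itv_partition 0 1 s &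
    forall k, (k < size s)%N ->
      let J : interval R := (`[nth 0 (0 :: s) k, nth 0 (0 :: s) k.+1[) in
      {in J &, {homo T : x y / x <= y}} /\
      {in J &, forall x y, `|T x - T y| = `|x - y|}.

(* A measurable map defined almost everywhere is represented by a measurable
   extension to the whole space, e.g. by a constant. *)
Definition isomorphic d1 d2 (R : realType)
    (X : measurableType d1) (Y : measurableType d2)
    (mu : {measure set X -> \bar R}) (nu : {measure set Y -> \bar R})
    (T : X -> X) (S : Y -> Y) : Prop :=
  exists (phi : X -> Y) (psi : Y -> X),
    [/\ measurable_fun setT phi /\ measurable_fun setT psi,
        forall B, measurable B -> pushforward mu phi B = nu B,
        {ae mu, forall x, psi (phi x) = x},
        {ae nu, forall y, phi (psi y) = y} &
        {ae nu, forall y, S y = phi (T (psi y))}].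

(* Main.v *)
Require Import Defs.
From HB Require Import structures.
From mathcomp Require Import all_boot all_order all_algebra.
From mathcomp Require Import all_classical all_reals all_analysis.
From mathcomp Require Import borel_hierarchy.
From mathcomp Require Import measurable_realfun perm zify lra ring.

(* Fix A = [0, 1/2) and code a point x by the bits [S^t x \in A], t < n. If S is
   isomorphic to an interval exchange T, the image of A is, up to a small error,
   a union of finitely many intervals, and an itinerary of length n of T through
   these is determined by the position among O(n) points. So, for some L and all
   n, some Hamming ball of radius n/8 among the words of length n is the code of
   a set of measure at least 1/(L(n+1)). The set G consists of S such that, for
   every N, there is an n for which all these balls have measure less than
   1/(N(n+1)); it is the intersection over N of the unions of suitable weak
   neighbourhoods of the transformations that have this property for N.

   Density needs no completeness of the weak topology, because explicit
   transformations that have the property for all N at once are dense. A given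
   transformation is first approximated by a permutation p of b intervals of
   equal length. In base b, p is then replaced by a map of digit sequences: the
   first digit, which gives the position, is moved by p at each time step, except
   that every b steps it is exchanged for a fresh digit from a two-sided shift.
   The blocks of length b of the code of this map are independent, and in each of
   them the expected number of disagreements with a given word is b/2, so an
   exponential moment estimate gives balls of exponentially small measure. *)

Set Implicit Arguments.
Unset Strict Implicit.
Unset Printing Implicit Defensive.

Import Order.TTheory GRing.Theory Num.Theory.
Import numFieldNormedType.Exports.

Local Open Scope classical_set_scope.
Local Open Scope ring_scope.

(** * Lebesgue measure on [0, 1] *)

Section vol.
Variable R : realType.
Implicit Types X Y Z A : set R.

Definition I01 : set R := [set` `[0, 1]].

(* Sets of reals are considered modulo what lies outside [0, 1]. *)
Definition meas01 X := measurable (X `&` I01).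

Definition vol X : R := fine (leb_on `[0, 1] X).

Lemma measurable_I01 : measurable I01.
Proof. exact: measurable_itv. Qed.

Lemma meas01W X : measurable X -> meas01 X.
Proof. by move=> mX; apply: measurableI => //; exact: measurable_I01. Qed.

Lemma meas01U X Y : meas01 X -> meas01 Y -> meas01 (X `|` Y).
Proof. by move=> mX mY; rewrite /meas01 setIUl; exact: measurableU. Qed.

Lemma meas01C X : meas01 X -> meas01 (~` X).
Proof.
move=> mX; rewrite /meas01.
have -> : ~` X `&` I01 = I01 `\` (X `&` I01).
  by apply/seteqP; split => x /=; tauto.
by apply: measurableD => //; exact: measurable_I01.
Qed.

Lemma meas01I X Y : meas01 X -> meas01 Y -> meas01 (X `&` Y).
Proof.
by move=> mX mY; rewrite -[X `&` Y]setCK setCI; apply: meas01C; apply: meas01U;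
  exact: meas01C.
Qed.

Lemma meas01D X Y : meas01 X -> meas01 Y -> meas01 (X `\` Y).
Proof. by move=> mX mY; rewrite setDE; apply: meas01I => //; exact: meas01C. Qed.

Lemma meas01Y X Y : meas01 X -> meas01 Y -> meas01 (X `+` Y).
Proof. by move=> mX mY; apply: meas01U; exact: meas01D. Qed.

Lemma meas01_bigcup (F : nat -> set R) :
  (forall n, meas01 (F n)) -> meas01 (\bigcup_n F n).
Proof. by move=> mF; rewrite /meas01 setI_bigcupl; apply: bigcup_measurable => n _;
  exact: mF. Qed.

Lemma meas01_ex (J : finType) (P : pred J) (F : J -> set R) :
  (forall j, P j -> meas01 (F j)) -> meas01 [set x | exists2 j, P j & F j x].
Proof.
move=> mF; rewrite /meas01.
have -> : [set x | exists2 j, P j & F j x] `&` I01 =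
    \bigcup_(j in [set j | P j]) (F j `&` I01).
  by apply/seteqP; split=> [x [[j]]|x [j] /= Pj []]; [exists j|split=> //; exists j].
by apply: fin_bigcup_measurable => // j /mF.
Qed.

Lemma meas01_ext X Y : (forall x, I01 x -> X x <-> Y x) -> meas01 X -> meas01 Y.
Proof.
move=> XY; rewrite /meas01; suff -> : X `&` I01 = Y `&` I01 by [].
by apply/seteqP; split=> x [] /[swap] Ix /(XY x Ix).
Qed.

Lemma leb_onE X : leb_on `[0, 1] X = lebesgue_measure (X `&` I01).
Proof. by []. Qed.

Lemma leb_on_vol X : meas01 X -> leb_on `[0, 1] X = (vol X)%:E.
Proof.
move=> mX; rewrite /vol fineK// leb_onE ge0_fin_numE// (@le_lt_trans _ _ 1%E) ?ltry//.
have <- : lebesgue_measure I01 = 1%E :> \bar R.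
  by rewrite /I01 lebesgue_measure_itv /= lte_fin ltr01 oppr0 adde0.
by apply: le_measure; rewrite ?inE//; exact: measurable_I01.
Qed.

Lemma lebesgue_vol X : measurable X -> X `<=` I01 -> lebesgue_measure X = (vol X)%:E.
Proof. by move=> mX XI; rewrite -leb_on_vol ?leb_onE ?(setIidl XI)//; exact: meas01W. Qed.

Lemma volT : vol setT = 1.
Proof.
by rewrite /vol leb_onE setTI /I01 lebesgue_measure_itv /= lte_fin ltr01 oppr0 adde0.
Qed.

Lemma vol_ge0 X : 0 <= vol X.
Proof. by rewrite /vol fine_ge0// leb_onE. Qed.

Lemma vol_ext X Y : (forall x, I01 x -> X x <-> Y x) -> vol X = vol Y.
Proof.
move=> XY; rewrite /vol !leb_onE; suff -> : X `&` I01 = Y `&` I01 by [].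
by apply/seteqP; split=> x [] /[swap] Ix /(XY x Ix).
Qed.

Lemma vol_le X Y : meas01 X -> meas01 Y -> (forall x, I01 x -> X x -> Y x) ->
  vol X <= vol Y.
Proof.
move=> mX mY XY; rewrite -lee_fin -!leb_on_vol// !leb_onE.
by apply: le_measure; rewrite ?inE// => x [] /[swap] Ix /(XY x Ix).
Qed.

Lemma vol_leU X Y Z : meas01 X -> meas01 Y -> meas01 Z ->
  (forall x, I01 x -> X x -> Y x \/ Z x) -> vol X <= vol Y + vol Z.
Proof.
move=> mX mY mZ XYZ; rewrite -lee_fin EFinD -!leb_on_vol//.
rewrite !leb_onE (le_trans _ (measureU2 _ _ _))//.
apply: le_measure; rewrite ?inE//; first exact: measurableU.
by move=> x [] /[swap] Ix /(XYZ x Ix)[]; [left|right].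
Qed.

Lemma vol0 : vol set0 = 0.
Proof. by rewrite /vol leb_onE set0I measure0. Qed.

Lemma vol_point a : vol [set a] = 0.
Proof.
apply/eqP; rewrite eq_le vol_ge0 andbT -lee_fin -leb_on_vol; last by apply: meas01W;
  exact: measurable_set1.
have <- : lebesgue_measure [set a] = 0%:E :> \bar R by exact: lebesgue_measure_set1.
rewrite leb_onE; apply: le_measure; rewrite ?inE.
- by apply: meas01W; exact: measurable_set1.
- exact: measurable_set1.
- by move=> x [].
Qed.

Lemma vol_label (J : finType) (f : R -> J) X :
  (forall j, meas01 (X `&` f @^-1` [set j])) -> meas01 X ->
  vol X = \sum_j vol (X `&` f @^-1` [set j]).
Proof.
move=> mf mX; apply: EFin_inj; rewrite -sumEFin -leb_on_vol//.
rewrite leb_onE (eq_bigr (fun j => lebesgue_measure (X `&` f @^-1` [set j] `&` I01))) =>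
  [|j _]; last by rewrite -leb_on_vol//; exact: mf.
have -> : X `&` I01 = \bigcup_(j in [set` index_enum J]) (X `&` f @^-1` [set j] `&` I01).
  apply/seteqP; split=> [x [Xx Ix]|x [j _] [[]]//].
  by exists (f x); rewrite //= mem_index_enum.
rewrite measure_fin_bigcup//.
- by rewrite -fsbig_seq ?index_enum_uniq.
- by move=> i j _ _ [x [[[_ <-] _] [[_ <-]]]].
- by move=> j _; exact: mf.
Qed.

Lemma vol_label_pred (J : finType) (f : R -> J) (U : set R) (P : pred J) :
  (forall j, meas01 (U `&` f @^-1` [set j])) ->
  meas01 [set x | U x /\ P (f x)] /\
  vol [set x | U x /\ P (f x)] = \sum_(j | P j) vol (U `&` f @^-1` [set j]).
Proof.
move=> mf; have mP : meas01 [set x | U x /\ P (f x)].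
  apply: (@meas01_ext [set x | exists2 j, P j & (U `&` f @^-1` [set j]) x]) => [x _|].
    split=> [[j Pj /= [Ux fx]]|/= [Ux Pf]]; first by rewrite fx.
    by exists (f x).
  by apply: meas01_ex => j _; exact: mf.
have fib j : P j -> [set x | U x /\ P (f x)] `&` f @^-1` [set j] =
    U `&` f @^-1` [set j].
  move=> Pj; apply/seteqP; split=> x /=; first by case=> -[].
  by case=> Ux fx; rewrite fx.
have fib0 j : ~~ P j -> [set x | U x /\ P (f x)] `&` f @^-1` [set j] = set0.
  move=> Pj; apply/seteqP; split=> x //= -[[_ Pf] fx].
  by move: Pj; rewrite -fx Pf.
split=> //; rewrite (vol_label (f := f))// => [|j]; last first.
  have [Pj|Pj] := boolP (P j); first by rewrite fib//; exact: mf.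
  by rewrite fib0//; apply: meas01W; exact: measurable0.
rewrite (bigID P) /= [X in _ + X]big1 ?addr0 => [|j Pj]; last by rewrite fib0// vol0.
by apply: eq_bigr => j Pj; rewrite fib.
Qed.

Lemma vol_label_const (J : finType) (f : R -> J) (U : set R) (c : R) (P : pred J) :
  (forall j, meas01 (U `&` f @^-1` [set j])) ->
  (forall j, vol (U `&` f @^-1` [set j]) = c) ->
  meas01 [set x | U x /\ P (f x)] /\ vol [set x | U x /\ P (f x)] = #|P|%:R * c.
Proof.
move=> mf cf; have [mP vP] := vol_label_pred P mf; split=> //.
by rewrite vP (eq_bigr (fun=> c)) => [|j _]; rewrite ?sumr_const ?mulr_natl.
Qed.

Lemma meas01_has (J : eqType) (s : seq J) (F : J -> set R) :
  (forall j, j \in s -> meas01 (F j)) -> meas01 [set x | exists2 j, j \in s & F j x].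
Proof.
elim: s => [|i s IHs] mF.
  apply: (@meas01_ext set0) => [x _|]; first by split=> // -[].
  by apply: meas01W; exact: measurable0.
apply: (@meas01_ext (F i `|` [set x | exists2 j, j \in s & F j x])) => [x _|].
  split=> [[Fi|[j js Fj]]|[j]]; first by exists i; rewrite ?mem_head.
    by exists j; rewrite // in_cons js orbT.
  by rewrite in_cons => /orP[/eqP->|js] Fj; [left|right; exists j].
apply: meas01U; first by apply: mF; rewrite mem_head.
by apply: IHs => j js; apply: mF; rewrite in_cons js orbT.
Qed.

Lemma vol_sum_le (J : eqType) (s : seq J) (F : J -> set R) X :
  meas01 X -> (forall j, j \in s -> meas01 (F j)) ->
  (forall x, I01 x -> X x -> exists2 j, j \in s & F j x) ->
  vol X <= \sum_(j <- s) vol (F j).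
Proof.
elim: s X => [|i s IHs] X mX mF XF.
  rewrite big_nil (@vol_ext _ set0) ?vol0// => x Ix; split=> // /(XF x Ix)[j].
  by rewrite in_nil.
have mFi : meas01 (F i) by apply: mF; rewrite mem_head.
have mFs j : j \in s -> meas01 (F j) by move=> js; apply: mF; rewrite in_cons js orbT.
rewrite big_cons; pose Y := [set x | exists2 j, j \in s & F j x].
have mY : meas01 Y by exact: meas01_has.
apply: (@le_trans _ _ (vol (F i) + vol Y)).
  apply: vol_leU => // x Ix /(XF x Ix)[j]; rewrite in_cons => /orP[/eqP->|js] Fj.
    by left.
  by right; exists j.
by rewrite lerD2l; apply: IHs.
Qed.

Lemma vol_sum_le_fin (J : finType) (P : pred J) (F : J -> set R) X :
  meas01 X -> (forall j, P j -> meas01 (F j)) ->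
  (forall x, I01 x -> X x -> exists2 j, P j & F j x) ->
  vol X <= \sum_(j | P j) vol (F j).
Proof.
move=> mX mF XF; rewrite -big_filter.
apply: vol_sum_le => // [j|x Ix Xx].
  by rewrite mem_filter => /andP[/mF].
by have [j Pj Fj] := XF x Ix Xx; exists j; rewrite // mem_filter Pj mem_index_enum.
Qed.

Lemma vol_bigcup_cvg (F : nat -> set R) : (forall n, meas01 (F n)) ->
  (forall n, F n `<=` F n.+1) -> vol (F n) @[n --> \oo] --> vol (\bigcup_n F n).
Proof.
move=> mF ndF; apply: fine_cvg.
rewrite fineK; last by rewrite leb_on_vol//; exact: meas01_bigcup.
rewrite leb_onE setI_bigcupl.
apply: (@nondecreasing_cvg_mu _ _ _ lebesgue_measure (fun n => F n `&` I01)) => //.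
  by apply: bigcup_measurable => n _; exact: mF.
by apply/nondecreasing_seqP => n; apply/subsetPset; exact: setSI.
Qed.

End vol.
Arguments I01 {R}.

(** * Cells of equal length *)

Section cells.
Variable R : realType.
Implicit Types (x y : R) (X Y : set R).

Definition cell (N : nat) x : nat := Num.truncn (N%:R * x).

Lemma cellP N x v : (0 < N)%N -> 0 <= x ->
  (cell N x == v) = (v%:R / N%:R <= x < v.+1%:R / N%:R).
Proof.
move=> N0 x0; have N0' : 0 < N%:R :> R by rewrite ltr0n.
rewrite /cell truncn_eq ?mulr_ge0// ?ler0n//.
by rewrite ler_pdivrMr// ltr_pdivlMr// [x * _]mulrC.
Qed.

Lemma cell_lt N x : (0 < N)%N -> 0 <= x < 1 -> (cell N x < N)%N.
Proof.
move=> N0 /andP[x0 x1]; rewrite /cell truncn_lt_nat ?mulr_ge0// ?ler0n//.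
by rewrite gtr_pMr// ltr0n.
Qed.

Definition U01 : set R := [set x | 0 <= x < 1].

Lemma U01I x : U01 x -> I01 x.
Proof. by rewrite /U01 /I01 /= in_itv /= => /andP[-> /ltW]. Qed.

Lemma U01_itv : U01 = [set` `[0, 1[].
Proof. by apply/seteqP; split=> x; rewrite /U01 /= in_itv. Qed.

Lemma measurable_U01 : measurable U01.
Proof. by rewrite U01_itv; exact: measurable_itv. Qed.

Lemma vol_itv (a c : R) : 0 <= a -> a <= c -> c <= 1 ->
  vol [set x | a <= x < c] = c - a.
Proof.
move=> a0 ac c1; apply: EFin_inj.
have -> : [set x | a <= x < c] = [set` `[a, c[].
  by apply/seteqP; split=> x /=; rewrite in_itv.
rewrite -lebesgue_vol ?lebesgue_measure_itv/=; last 2 first.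
- exact: measurable_itv.
- move=> x /=; rewrite /I01 /= !in_itv /= => /andP[ax xc].
  by rewrite (le_trans a0 ax) (le_trans (ltW xc) c1).
rewrite lte_fin; case: ltgtP ac => // -> _.
by rewrite subrr.
Qed.

Lemma cell_fibre N v : (v < N)%N ->
  U01 `&` [set x | cell N x = v] = [set x | v%:R / N%:R <= x < v.+1%:R / N%:R].
Proof.
move=> vN; have N0 : (0 < N)%N by exact: leq_ltn_trans vN.
have N0' : 0 < N%:R :> R by rewrite ltr0n.
apply/seteqP; split=> x.
  by move=> [/andP[x0 x1] /eqP]; rewrite cellP.
move=> /= vxv; have x0 : 0 <= x.
  by case/andP: vxv => + _; apply: le_trans; rewrite divr_ge0.
split; last by apply/eqP; rewrite cellP.
rewrite /U01 /= x0 /=; case/andP: vxv => _ /lt_le_trans; apply.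
by rewrite ler_pdivrMr// mul1r ler_nat.
Qed.

Lemma measurable_cell_fibre N v : measurable (U01 `&` [set x | cell N x = v]).
Proof.
have [vN|Nv] := ltnP v N.
  rewrite cell_fibre//.
  have -> : [set x | v%:R / N%:R <= x < v.+1%:R / N%:R] =
      [set` `[v%:R / N%:R, v.+1%:R / N%:R[] :> set R.
    by apply/seteqP; split=> x /=; rewrite in_itv.
  exact: measurable_itv.
case: N Nv => [|N] Nv.
  have [->|v0] := eqVneq v 0%N.
    have -> : [set x | cell 0 x = 0%N] = setT.
      by apply/seteqP; split=> // x _ /=; rewrite /cell mul0r truncn0.
    by rewrite setIT; exact: measurable_U01.
  have -> : [set x | cell 0 x = v] = set0.
    apply/seteqP; split=> // x /=; rewrite /cell mul0r truncn0 => v0'.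
    by rewrite -v0' in v0.
  by rewrite setI0.
have -> : U01 `&` [set x | cell N.+1 x = v] = set0; last by [].
apply/seteqP; split=> // x /= [xU xv].
by have := cell_lt (ltn0Sn N) xU; rewrite xv ltnNge Nv.
Qed.

Lemma vol_cell_fibre N v : (v < N)%N ->
  vol (U01 `&` [set x | cell N x = v]) = N%:R^-1.
Proof.
move=> vN; have N0 : (0 < N)%N by exact: leq_ltn_trans vN.
have N0' : 0 < N%:R :> R by rewrite ltr0n.
rewrite cell_fibre// vol_itv.
- by rewrite -mulrBl -natrB// subSnn mul1r.
- by rewrite divr_ge0.
- by rewrite ler_pM2r ?invr_gt0// ler_nat.
- by rewrite ler_pdivrMr// mul1r ler_nat.
Qed.

Lemma vol_cells N (P : pred nat) : (0 < N)%N ->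
  meas01 [set x | U01 x /\ P (cell N x)] /\
  vol [set x | U01 x /\ P (cell N x)] = #|[pred v : 'I_N | P v]|%:R / N%:R.
Proof.
case: N => // N _; pose f x : 'I_N.+1 := inord (cell N.+1 x).
have fE (j : 'I_N.+1) : U01 `&` f @^-1` [set j] = U01 `&` [set x | cell N.+1 x = j].
  apply/seteqP; split=> x /= [xU].
    by move=> <-; rewrite /f inordK//; exact: cell_lt.
  by move=> xj; split=> //; apply: val_inj; rewrite /f/= inordK// xj.
have [|j|mP vP] := @vol_label_const _ _ f U01 (N.+1%:R)^-1 [pred v : 'I_N.+1 | P v].
- by move=> j; apply: meas01W; rewrite fE; exact: measurable_cell_fibre.
- by rewrite fE vol_cell_fibre.
- suff <- : [set x | U01 x /\ [pred v : 'I_N.+1 | P v] (f x)] =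
     [set x | U01 x /\ P (cell N.+1 x)] by [].
  by apply/seteqP; split=> x /= [xU]; rewrite /f inordK//; exact: cell_lt.
Qed.

(** Only the point 1 is lost, a null set. This reconciles the automorphisms, which act on [0, 1],
    with digit expansions and interval exchanges, which live on [0, 1). *)
Lemma vol_U01 X : meas01 X -> vol X = vol (U01 `&` X).
Proof.
move=> mX; have mU : meas01 U01 by apply: meas01W; exact: measurable_U01.
apply/eqP; rewrite eq_le; apply/andP; split; last first.
  by apply: vol_le => //; [exact: meas01I|move=> x _ []].
rewrite -[leRHS]addr0 -(vol_point 1); apply: vol_leU => //; first exact: meas01I.
  by apply: meas01W; exact: measurable_set1.
move=> x; rewrite /I01 /= in_itv /= => /andP[x0 x1] Xx.
have [xlt|] := ltP x 1; first by left; split; rewrite // /U01 /= x0.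
by move=> x1'; right; apply/eqP; rewrite eq_le x1.
Qed.

Lemma cell_divn N K x : (0 < N)%N -> (0 < K)%N -> 0 <= x ->
  (cell (N * K) x %/ K)%N = cell N x.
Proof.
move=> N0 K0 x0; have N0' : 0 < N%:R :> R by rewrite ltr0n.
have K0' : 0 < K%:R :> R by rewrite ltr0n.
have := truncn_itv (mulr_ge0 (ler0n R (N * K)) x0).
rewrite -/(cell _ _); set v := cell _ _ => /andP[v1 v2].
apply/esym/eqP; rewrite /cell truncn_eq ?mulr_ge0//.
have [e1 e2] : (v %/ K * K <= v)%N /\ (v.+1 <= (v %/ K).+1 * K)%N.
  by split; [exact: leq_trunc_div|rewrite -ltn_divLR//].
move: e1 e2; rewrite -!(ler_nat R) !natrM => e1 e2.
rewrite -(ler_pM2r K0') -(ltr_pM2r K0'); rewrite natrM in v1 v2; apply/andP; split.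
  by apply: le_trans e1 _; rewrite mulrAC.
by apply: lt_le_trans e2; rewrite mulrAC.
Qed.

End cells.
Arguments U01 {R}.

(** * Automorphisms and codes *)

Section code.
Variable R : realType.
Implicit Types (f g : R -> R) (X Y : set R).

(** Hamming distance between the first [n] letters of [w] and those of the code of [x] with respect
    to the set of points below 1/2. *)
Definition code_miss f (w : nat -> bool) (n : nat) (x : R) : nat :=
  (\sum_(t < n) ((iter t f x < 2^-1)%R != w t))%N.

Definition code_ball f (w : nat -> bool) (n : nat) : set R :=
  [set x | (8 * code_miss f w n x <= n)%N].

Section autom.
Variable f : R -> R.
Hypothesis af : is_autom f.

Lemma autom_in x : I01 x -> I01 (f x).
Proof. by case: af => -[f' [+ _ _ _ _] _]; apply. Qed.

Lemma autom_inj x y : I01 x -> I01 y -> f x = f y -> x = y.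
Proof.
by case: af => -[f' [_ _ [fK _] _ _] _] Ix Iy e; rewrite -(fK x)// e fK.
Qed.

Lemma meas01_autom X : meas01 X -> meas01 (f @^-1` X).
Proof.
move=> mX; case: (af) => -[f' [_ _ _ mf _] _].
have := mf (@measurable_I01 R) _ mX; rewrite /meas01.
suff -> : I01 `&` f @^-1` (X `&` I01) = f @^-1` X `&` I01 by [].
apply/seteqP; split=> x; first by case=> Ix [].
by case=> Xfx Ix; split=> //; split=> //; exact: autom_in.
Qed.

Lemma vol_autom X : meas01 X -> vol (f @^-1` X) = vol X.
Proof.
move=> mX; have [_ pf] := af.
have := congr1 fine (pf _ mX); rewrite -[LHS]/(vol (f @^-1` (X `&` I01))) -[RHS]/(vol _).
rewrite (@vol_ext _ (f @^-1` (X `&` I01)) (f @^-1` X)); last first.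
  by move=> x Ix; split=> [[]//|]; split=> //; exact: autom_in.
move=> ->; apply: vol_ext => x Ix; split=> [[]//|]; by split.
Qed.

Lemma autom_iter_in t x : I01 x -> I01 (iter t f x).
Proof. by move=> Ix; elim: t => //= t; exact: autom_in. Qed.

Lemma meas01_iter t X : meas01 X -> meas01 (iter t f @^-1` X).
Proof.
elim: t X => // t IHt X mX.
rewrite (_ : iter t.+1 f @^-1` X = iter t f @^-1` (f @^-1` X))//.
by apply: IHt; exact: meas01_autom.
Qed.

Lemma vol_iter t X : meas01 X -> vol (iter t f @^-1` X) = vol X.
Proof.
elim: t X => // t IHt X mX.
rewrite (_ : iter t.+1 f @^-1` X = iter t f @^-1` (f @^-1` X))//.
by rewrite IHt ?vol_autom//; exact: meas01_autom.
Qed.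

(** The image is the preimage under the inverse map, which is measurable too. *)
Lemma meas01_image X : meas01 X -> X `<=` I01 -> measurable (f @` X).
Proof.
move=> mX XI; case: (af) => -[f' [If If' [fK f'K] _ mf'] _].
have := mf' (@measurable_I01 R) _ mX.
suff -> : I01 `&` f' @^-1` (X `&` I01) = f @` X by [].
apply/seteqP; split=> [y [Iy [/= Xf'y _]]|_ [x Xx <-]].
  by exists (f' y) => //; exact: f'K.
have Ix := XI _ Xx.
by split; [exact: If|rewrite /= fK].
Qed.

Lemma image_I01 X : X `<=` I01 -> f @` X `<=` I01.
Proof. by move=> XI _ [x Xx <-]; apply: autom_in; exact: XI. Qed.

(** Pulling both sets back by [f] preserves the measure and turns the image of [X] into [X] again.
    Distances of images, as in the weak topology, thus become distances of preimages. *)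
Lemma vol_image X Y : meas01 X -> X `<=` I01 -> meas01 Y ->
  vol (f @` X `+` Y) = vol (X `+` f @^-1` Y).
Proof.
move=> mX XI mY.
have mfX : meas01 (f @` X) by apply: meas01W; exact: meas01_image.
rewrite -(vol_autom (meas01Y mfX mY)); apply: vol_ext => x Ix /=.
have fX : (f @` X) (f x) <-> X x.
  by split=> [[z Xz /autom_inj <-//]|Xx]; [exact: XI|exists x].
by split=> -[[/fX ? ?]|[? /fX ?]]; [left|right|left|right]; split=> //; exact/fX.
Qed.

End autom.

Definition bits f n x : {ffun 'I_n -> bool} := [ffun t : 'I_n => (iter t f x < 2^-1)%R].

Lemma meas01_half : meas01 [set x : R | (x < 2^-1)%R].
Proof.
apply: meas01W; rewrite (_ : mkset _ = [set` `]-oo, 2^-1[]); last first.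
  by apply/seteqP; split=> x /=; rewrite in_itv.
exact: measurable_itv.
Qed.

Lemma meas01_bits f n (P : pred {ffun 'I_n -> bool}) : is_autom f ->
  meas01 [set x | P (bits f n x)].
Proof.
move=> af.
apply: (@meas01_ext _ [set x | exists2 v, P v & (bits f n @^-1` [set v]) x]) => [x _|].
  by split=> [[v Pv /= ->//]|Pf]; exists (bits f n x).
apply: meas01_ex => v _.
have mt (t : 'I_n) : meas01 [set x | (iter t f x < 2^-1)%R != v t].
  have mt := meas01_iter af t meas01_half.
  case vt: (v t).
    apply: meas01_ext (meas01C mt) => x _ /=.
    by rewrite eqb_id; split=> /negP.
  by apply: meas01_ext mt => x _ /=; rewrite eqbF_neg negbK.
apply: (@meas01_ext _ (~` [set x | exists2 t : 'I_n, xpredT t &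
    [set x | (iter t f x < 2^-1)%R != v t] x])).
  move=> x _ /=; split=> [h|<- [t _ /=]]; last by rewrite /bits ffunE eqxx.
  apply/ffunP => t; rewrite /bits ffunE; apply/eqP; apply: contra_notT h => h.
  by exists t.
by apply: meas01C; apply: meas01_ex.
Qed.

Lemma meas01_code_ball f w n : is_autom f -> meas01 (code_ball f w n).
Proof.
move=> af; pose P (v : {ffun 'I_n -> bool}) := (8 * \sum_(t < n) (v t != w t) <= n)%N.
have := @meas01_bits f n P af; apply: meas01_ext => x _.
have E : P (bits f n x) = (8 * code_miss f w n x <= n)%N.
  by rewrite /P /code_miss; congr (8 * _ <= _)%N; apply: eq_bigr => t _; rewrite ffunE.
by rewrite /code_ball /= E.
Qed.

End code.

(** * Digit expansions *)

Section digits.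
Variables (R : realType) (M : nat).
Hypothesis M0 : (0 < M)%N.
Implicit Types (x y : R) (s : nat -> 'I_M.+1).
Local Notation b := M.+1.

Definition dig x (j : nat) : 'I_b := inord (cell (b ^ j.+1) x %% b).

(** The number whose base [b] digits are the first [n] terms of [s], the most significant one
    first. *)
Fixpoint vcode s n : nat := if n is n'.+1 then (vcode s n' * b + s n')%N else 0%N.

(* The sequences that are digit expansions: not eventually equal to the last
   digit. *)
Definition unsaturated s := forall n, exists2 m, (n <= m)%N & s m != ord_max.

Definition dval s : R := sup (range (fun n => (vcode s n)%:R / (b ^ n)%:R : R)).

Lemma cell_dig x n : 0 <= x -> cell (b ^ n.+1) x = (cell (b ^ n) x * b + dig x n)%N.
Proof.
move=> x0; rewrite /dig inordK ?ltn_mod// {1}(divn_eq (cell (b ^ n.+1) x) b).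
by rewrite expnSr cell_divn// expn_gt0.
Qed.

Lemma cell_vcode x n : U01 x -> cell (b ^ n) x = vcode (dig x) n.
Proof.
move=> /andP[x0 x1]; elim: n => [|n IHn] /=; last by rewrite cell_dig// IHn.
by apply/eqP; rewrite -leqn0 -ltnS expn0; apply: cell_lt => //; rewrite x0.
Qed.

Lemma eq_vcode s s' n : vcode s n = vcode s' n <-> forall j, (j < n)%N -> s j = s' j.
Proof.
elim: n => [|n IHn] //=; split=> [e j jn|e]; last first.
  by rewrite e// (IHn.2 _)// => j jn; apply: e; rewrite ltnS ltnW.
have := congr1 (divn^~ b) e; rewrite !divnMDl// !divn_small// !addn0 => /IHn e'.
have := congr1 (modn^~ b) e; rewrite !modnMDl !modn_small// => e''.
by move: jn; rewrite ltnS leq_eqVlt => /orP[/eqP->|/e'//]; exact: val_inj.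
Qed.

Lemma vcode_lt s n : (vcode s n < b ^ n)%N.
Proof.
elim: n => //= n IHn; rewrite expnSr; apply: (@leq_trans ((vcode s n).+1 * b)).
  by rewrite mulSn addnC ltn_add2r ltn_ord.
by rewrite leq_mul2r orbC IHn.
Qed.

Lemma vcode_le s n k :
  (vcode s n * b ^ k <= vcode s (k + n) /\
   vcode s (k + n) < (vcode s n).+1 * b ^ k)%N.
Proof.
elim: k => [|k [IH1 IH2]]; first by rewrite !expn0 !muln1.
rewrite addSn /= expnSr !mulnA; split.
  by apply: (leq_trans _ (leq_addr _ _)); rewrite leq_mul2r IH1 orbT.
apply: (@leq_trans ((vcode s (k + n)).+1 * b)); last by rewrite leq_mul2r IH2 orbT.
by rewrite mulSn addnC ltn_add2r ltn_ord.
Qed.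

Let bX n : 0 < (b ^ n)%:R :> R.
Proof. by rewrite ltr0n expn_gt0. Qed.

Lemma vcode_mono s n k :
  (vcode s n)%:R / (b ^ n)%:R <= (vcode s (k + n))%:R / (b ^ (k + n))%:R :> R.
Proof.
rewrite ler_pdivrMr// mulrAC ler_pdivlMr// expnD -!natrM ler_nat mulnA.
by rewrite leq_mul2r (vcode_le s n k).1 orbT.
Qed.

Lemma vcode_mono' s n k :
  (vcode s (k + n)).+1%:R / (b ^ (k + n))%:R <= (vcode s n).+1%:R / (b ^ n)%:R :> R.
Proof.
rewrite ler_pdivrMr// mulrAC ler_pdivlMr// expnD -!natrM ler_nat mulnA.
by rewrite leq_mul2r (vcode_le s n k).2 orbT.
Qed.

Lemma vcode_cross s n m :
  (vcode s n)%:R / (b ^ n)%:R <= (vcode s m).+1%:R / (b ^ m)%:R :> R.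
Proof.
have [nm|/ltnW mn] := leqP n m.
  apply: (le_trans (vcode_mono s n (m - n))); rewrite subnK//.
  by rewrite ler_pM2r ?invr_gt0// ler_nat.
apply: le_trans (vcode_mono' s m (n - m)); rewrite subnK//.
by rewrite ler_pM2r ?invr_gt0// ler_nat.
Qed.

(** The upper bound is strict because some digit from place [n] on is not the last one, which leaves
    room for one more unit at that place. *)
Lemma dval_itv s n : unsaturated s ->
  (vcode s n)%:R / (b ^ n)%:R <= dval s < (vcode s n).+1%:R / (b ^ n)%:R.
Proof.
move=> /(_ n)[m nm sm].
have hs (m' : nat) : has_sup (range (fun n => (vcode s n)%:R / (b ^ n)%:R : R)).
  split; first by exists ((vcode s 0)%:R / (b ^ 0)%:R), 0%N.
  by exists ((vcode s m').+1%:R / (b ^ m')%:R) => _ [k _ <-]; exact: vcode_cross.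
apply/andP; split; first by apply: ub_le_sup; [exact: (hs 0%N).2|exists n].
apply: (@le_lt_trans _ _ ((vcode s m.+1).+1%:R / (b ^ m.+1)%:R)).
  by apply: sup_le_ub; [exact: (hs 0%N).1|move=> _ [k _ <-]; exact: vcode_cross].
apply: (@lt_le_trans _ _ ((vcode s m).+1%:R / (b ^ m)%:R)); last first.
  by rewrite -(subnK nm); exact: vcode_mono'.
rewrite ltr_pdivrMr// mulrAC ltr_pdivlMr// expnSr -!natrM ltr_nat mulnA.
rewrite [X in (_ < X)%N]mulnAC ltn_pmul2r ?expn_gt0//= -addnS mulSn addnC ltn_add2r.
have := ltn_ord (s m); rewrite ltnS leq_eqVlt => /orP[/eqP e|]; last by rewrite ltnS.
by move: sm; rewrite -val_eqE /= e eqxx.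
Qed.

Lemma dval_U01 s : unsaturated s -> U01 (dval s).
Proof.
move=> /(@dval_itv s 0%N) /=; rewrite expn0 !divr1 => /andP[h1 h2].
by rewrite /U01 /= h1.
Qed.

Lemma cell_dval s n : unsaturated s -> cell (b ^ n) (dval s) = vcode s n.
Proof.
move=> ps; apply/eqP; rewrite cellP ?dval_itv ?expn_gt0//.
by case/andP: (dval_U01 ps).
Qed.

Lemma dvalK s : unsaturated s -> dig (dval s) = s.
Proof.
move=> ps; apply/funext => j.
have : vcode (dig (dval s)) j.+1 = vcode s j.+1.
  by rewrite -cell_vcode ?cell_dval//; exact: dval_U01.
by move=> /eq_vcode; apply.
Qed.

Lemma lt_invX (e : R) : 0 < e -> exists n, ((b ^ n)%:R)^-1 < e.
Proof.
move=> e0; have [n ne] : exists n, e^-1 < n%:R.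
  by exists (Num.truncn e^-1).+1; exact: truncnS_gt.
exists n; rewrite invf_plt ?posrE//; apply: lt_le_trans ne _.
by rewrite ler_nat ltnW// ltn_expl.
Qed.

(** If all digits from place [n] on were the last one, the right end of the cell of [x] would be the
    same at all levels from [n] on, and [x] would be arbitrarily close to it; but [x] lies strictly
    below it. *)
Lemma unsaturated_dig x : U01 x -> unsaturated (dig x).
Proof.
move=> Ux n; apply: contrapT => nE.
have dmax m : (n <= m)%N -> dig x m = ord_max.
  by move=> nm; apply: contrapT => /eqP dm; apply: nE; exists m.
have x0 : 0 <= x by case/andP: Ux.
have cE k : (cell (b ^ (k + n)) x).+1 = ((cell (b ^ n) x).+1 * b ^ k)%N.
  elim: k => [|k IH]; first by rewrite muln1.
  rewrite addSn cell_dig// dmax ?leq_addl//= expnSr mulnA -IH mulSn.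
  by rewrite -addnS addnC.
have cI k : (cell (b ^ k) x)%:R / (b ^ k)%:R <= x < (cell (b ^ k) x).+1%:R / (b ^ k)%:R.
  by rewrite -cellP// expn_gt0.
have /andP[_] := cI n; rewrite -subr_gt0 => /lt_invX[k].
rewrite ltNge => /negP; apply.
have /andP[+ _] := cI (k + n)%N; have e1 := cE k.
have -> : (cell (b ^ (k + n)) x)%:R = (cell (b ^ n) x).+1%:R * (b ^ k)%:R - 1 :> R.
  by rewrite -natrM -e1 -natr1 addrK.
rewrite expnD natrM => h; have Bk := bX k; have Bn := bX n.
have e2 : ((cell (b ^ n) x).+1%:R * (b ^ k)%:R - 1) / ((b ^ k)%:R * (b ^ n)%:R) =
    (cell (b ^ n) x).+1%:R / (b ^ n)%:R - (b ^ k)%:R^-1 * (b ^ n)%:R^-1 :> R.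
  by field; rewrite !gt_eqF.
have : (b ^ k)%:R^-1 * (b ^ n)%:R^-1 <= (b ^ k)%:R^-1 :> R.
  by rewrite ler_piMr ?invr_ge0 ?ler0n// invf_le1// ler1n expn_gt0.
by move: h; rewrite e2; lra.
Qed.

(** Both points lie in the same cell at every level. *)
Lemma digK x : U01 x -> dval (dig x) = x.
Proof.
move=> Ux; have x0 : 0 <= x by case/andP: Ux.
apply/eqP; rewrite -subr_eq0 -normr_le0 leNgt; apply/negP => /lt_invX[k].
rewrite ltNge => /negP; apply.
have := dval_itv k (unsaturated_dig Ux); rewrite -cell_vcode//.
have : (cell (b ^ k) x)%:R / (b ^ k)%:R <= x < (cell (b ^ k) x).+1%:R / (b ^ k)%:R.
  by rewrite -cellP// expn_gt0.
rewrite -natr1 mulrDl mul1r => /andP[h1 h2] /andP[h3 h4].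
by rewrite ler_norml; apply/andP; split; lra.
Qed.

Lemma dig_inj x y : U01 x -> U01 y -> dig x = dig y -> x = y.
Proof. by move=> Ux Uy e; rewrite -(digK Ux) e digK. Qed.

Lemma cylinderE s n : U01 `&` [set x | cell (b ^ n) x = vcode s n] =
  U01 `&` [set x | forall j, (j < n)%N -> dig x j = s j].
Proof.
by apply/seteqP; split=> x /= [Ux]; rewrite cell_vcode// => /eq_vcode.
Qed.

Lemma vol_digs n (P : pred {ffun 'I_n -> 'I_b}) :
  meas01 [set x | U01 x /\ P [ffun j : 'I_n => dig x j]] /\
  vol [set x | U01 x /\ P [ffun j : 'I_n => dig x j]] = #|P|%:R / (b ^ n)%:R.
Proof.
pose f x := [ffun j : 'I_n => dig x j].
have fE (g : {ffun 'I_n -> 'I_b}) : U01 `&` f @^-1` [set g] =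
    U01 `&` [set x | cell (b ^ n) x = vcode (fun j => odflt ord0 (omap g (insub j))) n].
  rewrite cylinderE; apply/seteqP; split=> x /= [Ux].
    by move=> <-; split=> // j jn; rewrite insubT /= ffunE.
  move=> e; split=> //; apply/ffunP => j; rewrite ffunE e// valK /=.
  by [].
apply: vol_label_const => g; rewrite fE.
  by apply: meas01W; exact: measurable_cell_fibre.
by rewrite vol_cell_fibre// vcode_lt.
Qed.

(** Digits at distinct places are independent and uniform: of the words that cover all places [k j],
    those with [n] prescribed digits are counted. *)
Lemma vol_cylinder (k : nat -> nat) (n : nat) (s : nat -> 'I_b) :
  (forall i j, (i < n)%N -> (j < n)%N -> k i = k j -> i = j) ->
  meas01 [set x | U01 x /\ forall j, (j < n)%N -> dig x (k j) = s j] /\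
  vol [set x | U01 x /\ forall j, (j < n)%N -> dig x (k j) = s j] = ((b ^ n)%:R)^-1.
Proof.
move=> kinj; pose m := (\max_(j < n) k j).+1.
have km j : (j < n)%N -> (k j < m)%N.
  by move=> jn; rewrite ltnS; exact: (@leq_bigmax _ (fun i : 'I_n => k i) (Ordinal jn)).
(* The digits allowed at place [i]: a single one if [i] is some [k j], and all [b] of them
   otherwise. *)
pose F (i : 'I_m) : pred 'I_b :=
  [pred a | [forall j : 'I_n, (k j == i) ==> (a == s j)]].
have [mP vP] := @vol_digs m (family F).
have E : [set x | U01 x /\ family F [ffun j : 'I_m => dig x j]] =
    [set x | U01 x /\ forall j, (j < n)%N -> dig x (k j) = s j].
  apply/seteqP; split=> x /= [Ux h]; split=> //.
    move=> j jn; have := h.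
    move=> /forallP /(_ (Ordinal (km j jn)));
      rewrite ffunE /= => /forallP /(_ (Ordinal jn)).
    by rewrite eqxx => /eqP.
  apply/forallP => i; rewrite ffunE inE; apply/forallP => j; apply/implyP => /eqP <-.
  by apply/eqP; exact: h.
rewrite E in mP vP; split=> //; rewrite vP.
pose f0 (j : 'I_n) := Ordinal (km j (ltn_ord j)).
have f0_inj : injective f0 by move=> i j [] /kinj e; apply: val_inj; exact: e.
have nm : (n <= m)%N.
  by have := max_card (mem (codom f0)); rewrite card_codom// !card_ord.
have -> : #|family F| = (b ^ (m - n))%N.
  rewrite card_family.
  have kK : #|codom f0| = n by rewrite card_codom// card_ord.
  have cF i : #|F i| = (if i \in codom f0 then 1 else b)%N.
    case: ifPn => [/codomP[j ->]|ni].
      rewrite -(card1 (s j)); apply: eq_card => a; rewrite !inE.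
      apply/forallP/eqP => [/(_ j)|-> j']; first by rewrite eqxx => /eqP.
      by apply/implyP => /eqP /kinj e; apply/eqP; congr s; apply/esym; exact: e.
    rewrite -[RHS]card_ord; apply: eq_card => a; rewrite !inE.
    apply/forallP => j; apply/implyP => /eqP kj.
    by case/negP: ni; apply/codomP; exists j; apply: val_inj.
  rewrite foldrE big_map big_enum /=.
  under eq_bigr do rewrite cF.
  rewrite (bigID (mem (codom f0))) /= big1 => [|i ->//]; rewrite mul1n.
  rewrite (eq_bigr (fun=> b)) => [|i /negbTE ->//].
  rewrite prod_nat_const; congr (_ ^ _)%N.
  have := cardC (mem (codom f0)); rewrite kK card_ord => e.
  by apply: (@addnI n); rewrite subnKC// -[RHS]e; congr (_ + _)%N; apply: eq_card.
by rewrite -{2}(subnK nm) expnD natrM invfM mulrA divff ?mul1r//.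
Qed.

End digits.

(** * Transformations acting on digits *)

Section rays.
Variable R : realType.
Implicit Types (x y : R).
Variable T : R -> R.
Hypothesis T_out : forall y, ~ U01 y -> T y = y.
Hypothesis T_in : forall y, U01 y -> U01 (T y).
Hypothesis T_meas : forall x, 0 < x <= 1 -> measurable (U01 `&` [set y | T y < x]).

Lemma measurable_U01_ray x : measurable (U01 `&` [set y | T y < x]).
Proof.
have [x0|x0] := ltP 0 x; last first.
  suff -> : U01 `&` [set y | T y < x] = set0 by [].
  apply/seteqP; split=> // y /= [/T_in /andP[h _]] /lt_le_trans /(_ x0).
  by rewrite ltNge h.
have [x1|x1] := leP x 1; first by apply: T_meas; rewrite x0.
suff -> : U01 `&` [set y | T y < x] = U01 by exact: measurable_U01.
apply/seteqP; split=> [y []//|y Uy]; split=> //=.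
by have /andP[_ h] := T_in Uy; exact: lt_trans h x1.
Qed.

(** Rays generate the Borel sets, and since [T] maps [0, 1) to itself, only rays that end in (0, 1]
    need the hypothesis. *)
Lemma measurable_rays : measurable_fun setT T.
Proof.
apply: (measurability _ (RGenInftyO.measurableE R)) => _ [_ [x ->] <-].
rewrite setTI.
have -> : T @^-1` `]-oo, x[%classic = (U01 `&` [set y | T y < x]) `|`
    (~` U01 `&` [set y | y < x]).
  apply/seteqP; split=> y /=; rewrite in_itv /=.
    move=> Tyx; have [Uy|Uy] := pselect (U01 y); first by left.
    by right; rewrite -{2}(T_out Uy).
  by case=> -[// Uy]; rewrite T_out.
apply: measurableU; first exact: measurable_U01_ray.
apply: measurableI; first by apply: measurableC; exact: measurable_U01.
by rewrite (_ : [set y | y < x] = `]-oo, x[%classic)//; apply/seteqP; split=> y /=;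
  rewrite in_itv.
Qed.

Hypothesis T_vol : forall x, 0 < x <= 1 -> vol (U01 `&` [set y | T y < x]) = x.

(** Rays are stable under intersection and generate the Borel sets, so it is enough that the two
    finite measures agree on them. *)
Lemma pushforward_rays (A : set R) :
  measurable A -> pushforward (leb_on `[0, 1]) T A = leb_on `[0, 1] A.
Proof.
have mT : measurable_fun setT (T : measurableTypeR R -> measurableTypeR R).
  exact: measurable_rays.
pose mT' : {measure set (measurableTypeR R) -> \bar R} :=
  measure_function_pushforward__canonical__measure_function_Measure (leb_on `[0, 1]) mT.
move=> mA.
apply: (@measure_unique _ R (measurableTypeR R) (@RGenInftyO.G R)
  (fun n => `]-oo, n%:R[%classic) (RGenInftyO.measurableE R)
  _ _ _ mT' (leb_on `[0, 1])) => //.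
- move=> _ _ [x ->] [y ->]; exists (Num.min x y); apply/seteqP.
  split=> z /=; rewrite !in_itv /= lt_min; first by case=> -> ->.
  by move=> /andP[].
- by move=> n; exists n%:R.
- apply/seteqP; split=> // x _; exists (Num.truncn x).+1 => //=.
  by rewrite in_itv /= truncnS_gt.
- move=> _ [x ->].
  have mx : measurable (`]-oo, x[%classic : set R) by exact: measurable_itv.
  have mTx : measurable (T @^-1` `]-oo, x[%classic) by rewrite -[X in measurable X]setTI;
    exact: (mT measurableT _ mx).
  change (leb_on `[0, 1] (T @^-1` `]-oo, x[%classic) = leb_on `[0, 1] `]-oo, x[%classic).
  rewrite [LHS]leb_on_vol; last exact: meas01W.
  rewrite leb_on_vol; last exact: meas01W.
  congr (_%:E); rewrite vol_U01; last exact: meas01W.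
  rewrite [RHS]vol_U01; last exact: meas01W.
  have -> : U01 `&` T @^-1` `]-oo, x[%classic = U01 `&` [set y | T y < x].
    by apply/seteqP; split=> y /=; rewrite in_itv.
  have -> : U01 `&` `]-oo, x[%classic = U01 `&` [set y | y < x].
    by apply/seteqP; split=> y /=; rewrite in_itv.
  have [x0|x0] := ltP 0 x; last first.
    congr vol; apply/seteqP; split=> y /= [Uy].
      have /andP[h _] := T_in Uy; move=> /lt_le_trans /(_ x0).
      by rewrite ltNge h.
    have /andP[h _] := Uy; move=> /lt_le_trans /(_ x0).
    by rewrite ltNge h.
  have [x1|x1] := leP x 1.
    rewrite T_vol ?x0// (_ : _ `&` _ = [set y | 0 <= y < x]).
      by rewrite vol_itv// ?subr0// ltW.
    apply/seteqP; split=> y /=; first by move=> [/andP[-> _] ->].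
    by move=> /andP[y0 yx]; split=> //; rewrite /U01 /= y0 (lt_le_trans yx).
  congr vol; apply/seteqP; split=> y /= [Uy _]; split=> //.
    by have /andP[_ h] := Uy; exact: lt_trans h x1.
  by have /andP[_ h] := T_in Uy; exact: lt_trans h x1.
- move=> k; change (leb_on `[0%R, 1%R] (T @^-1` `]-oo, k%:R%R[%classic) < +oo)%E.
  rewrite leb_on_vol ?ltry//; apply: meas01W; rewrite -[X in measurable X]setTI.
  by apply: (mT measurableT); exact: measurable_itv.
Qed.

End rays.

(** * Maps of digit sequences as automorphisms of [0, 1] *)

Section digit_maps.
Variables (R : realType) (M : nat).
Hypothesis M0 : (0 < M)%N.
Implicit Types (x y : R) (s : nat -> 'I_M.+1).
Local Notation b := M.+1.
Local Notation dig := (@dig R M).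
Local Notation dval := (@dval R M).

(** The identity outside [0, 1) fixes the point 1, so an invertible [F] can give a bijection of the
    closed interval. *)
Definition digit_map (F : (nat -> 'I_b) -> nat -> 'I_b) x : R :=
  if 0 <= x < 1 then dval (F (dig x)) else x.

Section one_map.
Variable F : (nat -> 'I_b) -> nat -> 'I_b.
Hypothesis F_unsat : forall s, unsaturated s -> unsaturated (F s).

Lemma digit_map_in y : U01 y -> U01 (digit_map F y).
Proof.
move=> Uy; rewrite /digit_map Uy; apply: dval_U01; apply: F_unsat.
exact: unsaturated_dig.
Qed.

Lemma digit_map_out y : ~ U01 y -> digit_map F y = y.
Proof. by move=> /negP Uy; rewrite /digit_map (negbTE Uy). Qed.

Lemma dig_digit_map y : U01 y -> dig (digit_map F y) = F (dig y).
Proof.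
move=> Uy; rewrite /digit_map Uy dvalK//; apply: F_unsat; exact: unsaturated_dig.
Qed.

(** Two points are in strict order as soon as their cells are, and a level whose cells are shorter
    than the distance of the points separates them. The ray becomes a countable union of conditions
    on finitely many digits. *)
Lemma digit_map_ray x : 0 < x <= 1 ->
  U01 `&` [set y | digit_map F y < x] =
  \bigcup_n (U01 `&` [set y | (vcode (F (dig y)) n < cell (b ^ n) x)%N]).
Proof.
move=> /andP[x0 x1].
have bX n : 0 < (b ^ n)%:R :> R by rewrite ltr0n expn_gt0.
apply/seteqP; split=> [y /= [Uy]|y [n _ /= [Uy]]].
  have /andP[d0 d1] := digit_map_in Uy.
  rewrite -subr_gt0 => /(lt_invX M0)[n hn].
  exists n => //; split=> //=.
  rewrite -(dig_digit_map Uy) -cell_vcode; last exact: digit_map_in.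
  rewrite truncn_ge_nat; last by rewrite mulr_ge0// ltW.
  have h : (cell (b ^ n) (digit_map F y))%:R <= (b ^ n)%:R * digit_map F y.
    by rewrite truncn_le mulr_ge0// ltW.
  have := hn; rewrite -(ltr_pM2l (bX n)) divff ?gt_eqF// mulrBr -natr1; lra.
rewrite -(dig_digit_map Uy) -cell_vcode; last exact: digit_map_in.
have Ud := digit_map_in Uy; have /andP[d0 d1] := Ud.
move=> h; split=> //; rewrite ltNge; apply/negP => xd.
move: h; rewrite ltnNge => /negP; apply; apply: le_truncn.
by rewrite ler_pM2l.
Qed.

Hypothesis F_meas : forall n s,
  meas01 [set x | U01 x /\ forall j, (j < n)%N -> F (dig x) j = s j].

Let F_fibre n v : (v < b ^ n)%N -> exists s, forall f : R -> 'I_(b ^ n),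
  (forall x, f x = vcode (F (dig x)) n :> nat) ->
  U01 `&` [set x | f x = v :> nat] =
  [set x | U01 x /\ forall j, (j < n)%N -> F (dig x) j = s j].
Proof.
move=> vb; have bX : 0 < (b ^ n)%:R :> R by rewrite ltr0n expn_gt0.
(* The left end of the cell [v]; its first [n] digits spell [v]. *)
pose z : R := v%:R / (b ^ n)%:R.
have Uz : U01 z.
  by rewrite /U01 /= divr_ge0 ?ler0n//= ltr_pdivrMr// mul1r ltr_nat.
exists (dig z) => f fE; have e : v = vcode (dig z) n.
  rewrite -cell_vcode//; apply/esym/eqP; rewrite cellP ?expn_gt0 ?(andP Uz).1//.
  by rewrite lexx /= /z ltr_pM2r ?invr_gt0// ltr_nat.
apply/seteqP; split=> x /= [Ux]; rewrite fE e => /eq_vcode //.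
Qed.

Let G n c := U01 `&` [set y : R | (vcode (F (dig y)) n < c)%N].

Let fn n (x : R) : 'I_(b ^ n) := Ordinal (vcode_lt (F (dig x)) n).

Let G_measurable n c : measurable (G n c).
Proof.
have mG : meas01 (G n c).
  apply: (@meas01_ext _ [set x | exists2 v : 'I_(b ^ n), (v < c)%N &
      (U01 `&` [set x | fn n x = v :> nat]) x]) => [x _|].
    split=> [[v vc [Ux /= h]]|[Ux /= h]]; first by split=> //=; rewrite h.
    by exists (fn n x).
  apply: meas01_ex => v _.
  have [s ->//] := F_fibre (ltn_ord v).
suff <- : G n c `&` I01 = G n c by [].
by apply/seteqP; split=> x []// Ux h; split=> //; exact: U01I.
Qed.

Lemma digit_map_meas : measurable_fun setT (digit_map F).
Proof.
apply: measurable_rays; [exact: digit_map_out|exact: digit_map_in|].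
move=> x xI; rewrite digit_map_ray//; apply: bigcup_measurable => n _.
exact: G_measurable.
Qed.

Hypothesis F_vol : forall n s,
  vol [set x | U01 x /\ forall j, (j < n)%N -> F (dig x) j = s j] = ((b ^ n)%:R)^-1.

Let G_vol n c : (c <= b ^ n)%N -> vol (G n c) = c%:R / (b ^ n)%:R.
Proof.
move=> cb.
have fib (j : 'I_(b ^ n)) :
  U01 `&` fn n @^-1` [set j] = U01 `&` [set x | fn n x = j :> nat].
  by apply/seteqP; split=> x [Ux] h; split=> //;
    [exact: (congr1 (@nat_of_ord _) h)|exact: val_inj].
have [j|j|_] := @vol_label_const _ _ (fn n) U01 ((b ^ n)%:R)^-1 [pred v :
  'I_(b ^ n) | (v < c)%N].
- by rewrite fib; have [s ->//] := F_fibre (ltn_ord j).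
- by rewrite fib; have [s ->//] := F_fibre (ltn_ord j).
rewrite (_ : [set x | _] = G n c)// => ->; congr (_%:R / _).
apply: (etrans _ (card_ord c)); rewrite -(card_codom (f := widen_ord cb)); last first.
  by move=> i j [] e; apply: val_inj.
apply: eq_card => v; rewrite inE; apply/idP/codomP => /= [vc|[u ->]]; last exact: ltn_ord u.
by exists (Ordinal vc); apply: val_inj.
Qed.

(** The preimage of the ray below [x] is an increasing union over the levels [n], and its part at
    level [n] has the measure of the cells before that of [x], which tends to [x]. *)
Lemma digit_map_pres (A : set R) : measurable A ->
  pushforward (leb_on `[0, 1]) (digit_map F) A = leb_on `[0, 1] A.
Proof.
apply: pushforward_rays; [exact: digit_map_out|exact: digit_map_in| |].
  move=> x xI; rewrite digit_map_ray//; apply: bigcup_measurable => n _.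
  exact: G_measurable.
move=> x xI; have /andP[x0 x1] := xI; rewrite digit_map_ray//.
have bX n : 0 < (b ^ n)%:R :> R by rewrite ltr0n expn_gt0.
have cb n : (cell (b ^ n) x <= b ^ n)%N.
  rewrite -ltnS truncn_lt_nat; last by rewrite mulr_ge0// ltW.
  apply: le_lt_trans (_ : (b ^ n)%:R < _); last by rewrite ltr_nat.
  by rewrite ger_pMr.
have h1 : vol (G n (cell (b ^ n) x)) @[n --> \oo] -->
    vol (\bigcup_n G n (cell (b ^ n) x)).
  apply: vol_bigcup_cvg => [n|n y /= [Uy h]]; first exact: meas01W.
  split=> //=; rewrite (cell_dig _ _ (ltW x0)).
  apply: (@leq_trans ((vcode (F (dig y)) n).+1 * b)).
    by rewrite mulSn addnC ltn_add2r ltn_ord.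
  by apply: (leq_trans _ (leq_addr _ _)); rewrite leq_mul2r h orbT.
have h2 : vol (G n (cell (b ^ n) x)) @[n --> \oo] --> x.
  apply/cvgrPdist_lt => e e0; have [m hm] := lt_invX M0 e0.
  exists m => // n /= mn; rewrite G_vol// ger0_norm.
    apply: le_lt_trans hm; rewrite lerBlDl.
    apply: (@le_trans _ _ ((cell (b ^ n) x)%:R / (b ^ n)%:R + (b ^ n)%:R^-1)).
      rewrite -[X in _ + X]mul1r -mulrDl natr1 ler_pdivlMr// mulrC.
      by apply: ltW; exact: truncnS_gt.
    rewrite lerD2l lef_pV2 ?posrE// ler_nat leq_exp2l//.
  rewrite subr_ge0 ler_pdivrMr// mulrC truncn_le.
  by rewrite mulr_ge0// ltW.
exact: (cvg_unique _ h1 h2).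
Qed.

End one_map.

Lemma is_autom_digit_map F F' :
  (forall s, unsaturated s -> unsaturated (F s)) -> (forall s, unsaturated s ->
    unsaturated (F' s)) ->
  (forall s, F' (F s) = s) -> (forall s, F (F' s) = s) ->
  (forall n s, meas01 [set x | U01 x /\ forall j, (j < n)%N -> F (dig x) j = s j]) ->
  (forall n s, meas01 [set x | U01 x /\ forall j, (j < n)%N -> F' (dig x) j = s j]) ->
  (forall n s, vol [set x | U01 x /\ forall j, (j < n)%N -> F (dig x) j = s j] =
     ((b ^ n)%:R)^-1) ->
  is_autom (digit_map F).
Proof.
move=> pF pF' FK FK' mF mF' vF.
have inI G : (forall s, unsaturated s -> unsaturated (G s)) ->
    set_fun [set` `[0, 1]] [set` `[0, 1]] (digit_map G).
  move=> pG x Ix; have [Ux|Ux] := pselect (U01 x); last by rewrite digit_map_out.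
  by apply: U01I; exact: digit_map_in.
have canI G G' : (forall s, unsaturated s -> unsaturated (G s)) ->
    (forall s, unsaturated s -> unsaturated (G' s)) -> (forall s, G' (G s) = s) ->
    forall x, digit_map G' (digit_map G x) = x.
  move=> pG pG' GK x; have [Ux|Ux] := pselect (U01 x); last by rewrite !digit_map_out.
  have UGx := digit_map_in pG Ux.
  apply: (@dig_inj R M M0) => //; first exact: digit_map_in.
  by rewrite !dig_digit_map.
split; last exact: digit_map_pres.
exists (digit_map F'); split; [exact: inI|exact: inI| | |].
- by split=> x _; exact: canI.
- by apply: measurable_funTS; exact: digit_map_meas.
- by apply: measurable_funTS; exact: digit_map_meas.
Qed.

End digit_maps.

(** * The step map *)

Section step.
Variables (M : nat) (p : {perm 'I_M.+1}).
Local Notation b := M.+1.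
Implicit Types s w : nat -> 'I_b.

(** The shift by one place along the line ..., 7, 5, 3, 0, 2, 4, 6, ..., with the clock place 1
    fixed. *)
Definition fetch k :=
  if odd k then (if k == 1 then 1 else if k == 3 then 0 else k - 2)%N else k.+2.
Definition unfetch k :=
  if k == 0 then 3 else (if odd k then (if k == 1 then 1 else k.+2) else k - 2)%N.

Lemma fetchK : cancel fetch unfetch.
Proof.
move=> k; rewrite /fetch /unfetch.
by repeat (match goal with |- context [if ?c then _ else _] => case: (boolP c) end); lia.
Qed.

Lemma unfetchK : cancel unfetch fetch.
Proof.
move=> k; rewrite /fetch /unfetch.
by repeat (match goal with |- context [if ?c then _ else _] => case: (boolP c) end); lia.
Qed.

Lemma fetch_ge k : (k <= (fetch k).+3)%N.
Proof.
rewrite /fetch.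
by repeat (match goal with |- context [if ?c then _ else _] => case: (boolP c) end); lia.
Qed.

Lemma unfetch_ge k : (k <= (unfetch k).+3)%N.
Proof.
rewrite /unfetch.
by repeat (match goal with |- context [if ?c then _ else _] => case: (boolP c) end); lia.
Qed.

Lemma fetch_eq1 k : (fetch k == 1) = (k == 1).
Proof. by rewrite -[RHS](can_eq fetchK). Qed.

Lemma unfetch_eq1 k : (unfetch k == 1) = (k == 1).
Proof. by rewrite -[RHS](can_eq unfetchK). Qed.

(* Digit 0 is the position and digit 1 is a clock; the digits 2, 4, 6, ... are
   the positions at the start of the future blocks, and 3, 5, 7, ... those of the
   past ones, so that [step] is invertible. *)
Definition step s : nat -> 'I_b := fun j =>
  if s 1%N != ord_max then
    if j == 0 then p (s 0%N) else if j == 1 then inord (s 1%N).+1 else s j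
  else if j == 1 then ord0 else s (fetch j).

Definition unstep s : nat -> 'I_b := fun j =>
  if s 1%N != ord0 then
    if j == 0 then p^-1%g (s 0%N) else if j == 1 then inord (s 1%N).-1 else s j
  else if j == 1 then ord_max else s (unfetch j).

Lemma clock_up (a : 'I_b) : a != ord_max -> (inord a.+1 : 'I_b) = a.+1 :> nat.
Proof.
move=> am; rewrite inordK// ltnS ltn_neqAle -ltnS ltn_ord andbT.
by apply: contra am => /eqP am; apply/eqP/val_inj.
Qed.

Lemma clock_down (a : 'I_b) : (inord a.-1 : 'I_b) = a.-1 :> nat.
Proof. by rewrite inordK// (leq_ltn_trans (leq_pred _)). Qed.

Lemma stepK : cancel step unstep.
Proof.
move=> s; apply/funext => j; rewrite /unstep /step /=.
have [s1|s1] := eqVneq (s 1%N) ord_max; rewrite /= ?eqxx /=.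
  by rewrite unfetch_eq1 unfetchK; case: eqP => [->|].
have -> : inord (s 1%N).+1 != ord0 :> 'I_b.
  by rewrite -val_eqE /= clock_up.
case: eqP => [->|_]; first by rewrite permK.
by case: eqP => [->|//]; apply: val_inj; rewrite /= clock_down clock_up.
Qed.

Lemma unstepK : cancel unstep step.
Proof.
move=> s; apply/funext => j; rewrite /unstep /step /=.
have [s1|s1] := eqVneq (s 1%N) ord0; rewrite /= ?eqxx /=.
  by rewrite fetch_eq1 fetchK; case: eqP => [->|].
have s1' : (0 < s 1%N)%N by rewrite lt0n -val_eqE /= in s1 *.
have -> : inord (s 1%N).-1 != ord_max :> 'I_b.
  by rewrite -val_eqE /= clock_down; have := ltn_ord (s 1%N); lia.
case: eqP => [->|_]; first by rewrite permKV.
by case: eqP => [->|//]; apply: val_inj; rewrite /= inordK ?clock_down prednK.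
Qed.

Lemma step_unsat s : unsaturated s -> unsaturated (step s).
Proof.
(* No place moves back by more than 3, and with 4 the place [m] also avoids the position and the
   clock. *)
move=> us n; have [m nm sm] := us (n + 4)%N.
rewrite /step; have [s1|s1] := eqVneq (s 1%N) ord_max.
  exists (unfetch m); last by rewrite unfetch_eq1 unfetchK ifF//; lia.
  by have := unfetch_ge m; lia.
exists m; first by lia.
by rewrite !ifF//; lia.
Qed.

Lemma unstep_unsat s : unsaturated s -> unsaturated (unstep s).
Proof.
move=> us n; have [m nm sm] := us (n + 4)%N.
rewrite /unstep; have [s1|s1] := eqVneq (s 1%N) ord0.
  exists (fetch m); last by rewrite fetch_eq1 fetchK ifF//; lia.
  by have := fetch_ge m; lia.
exists m; first by lia.
by rewrite !ifF//; lia.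
Qed.

(** The length is at least 2 so that the clock digit is prescribed: its value tells which branch of
    [step] was taken, hence whether the digits come from the same places or from those given by
    [fetch]. *)
Lemma step_cylinder w : exists2 k, injective k & forall n s,
  (forall j, (j < n.+2)%N -> step s j = w j) <->
  (forall j, (j < n.+2)%N -> s (k j) = unstep w (k j)).
Proof.
have [w1|w1] := eqVneq (w 1%N) ord0; last first.
  exists id => // n s; split=> h j jn.
    have := h 1%N isT; rewrite /step; case: ifPn => /= [s1 e1|_ e];
      last by rewrite -e eqxx in w1.
    rewrite /unstep w1; case: eqP => [->|/eqP j0].
      by rewrite -(h 0%N isT) /step s1 /= permK.
    case: eqP => [->|/eqP j1]; last by rewrite -(h j jn) /step s1 (negbTE j0) (negbTE j1).
    by apply: val_inj; rewrite /= clock_down -e1 clock_up.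
  have w1' : (0 < w 1%N)%N by rewrite lt0n -val_eqE /= in w1 *.
  have s1 := h 1%N isT; rewrite /unstep w1 /= in s1.
  have s1' : s 1%N != ord_max.
    by rewrite s1 -val_eqE /= clock_down; have := ltn_ord (w 1%N); lia.
  have := h j jn; rewrite /step s1' /unstep w1; case: eqP => [->|_].
    by move: (h 0%N isT); rewrite /unstep w1 /= => -> _; rewrite permKV.
  case: eqP => [-> _|//]; apply: val_inj; rewrite /= s1 inordK clock_down prednK//.
exists fetch => [|n s]; first exact: can_inj fetchK.
split=> h j jn.
  have := h 1%N isT; rewrite /step w1; case: ifPn => [s1 /(congr1 val)|].
    by rewrite /= clock_up.
  rewrite negbK => /eqP s1 _; rewrite /unstep w1 eqxx /= fetchK.
  have := h j jn; rewrite /step s1 eqxx /=; case: eqP => [-> _|j1 <-]; first by [].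
  by rewrite fetch_eq1; case: eqP j1.
have s1 := h 1%N isT; rewrite /unstep w1 /= in s1.
have := h j jn; rewrite /step s1 eqxx /=; case: eqP => [->//|j1 ->].
by rewrite /unstep w1 eqxx /= fetchK fetch_eq1; case: eqP j1.
Qed.

Lemma unstep_cylinder w : exists2 k, injective k & forall n s,
  (forall j, (j < n.+2)%N -> unstep s j = w j) <->
  (forall j, (j < n.+2)%N -> s (k j) = step w (k j)).
Proof.
have [w1|w1] := eqVneq (w 1%N) ord_max; last first.
  exists id => // n s; split=> h j jn.
    have := h 1%N isT; rewrite /unstep; case: ifPn => /= [s1 e1|_ e];
      last by rewrite -e eqxx in w1.
    have s1' : (0 < s 1%N)%N by rewrite lt0n -val_eqE /= in s1 *.
    rewrite /step w1; case: eqP => [->|/eqP j0].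
      by rewrite -(h 0%N isT) /unstep s1 /= permKV.
    case: eqP => [->|/eqP j1]; last by rewrite -(h j jn) /unstep s1 (negbTE j0) (negbTE j1).
    by apply: val_inj; rewrite /= -e1 inordK clock_down prednK.
  have s1 := h 1%N isT; rewrite /step w1 /= in s1.
  have s1' : s 1%N != ord0 by rewrite s1 -val_eqE /= clock_up.
  have := h j jn; rewrite /unstep s1' /step w1; case: eqP => [->|_].
    by move: (h 0%N isT); rewrite /step w1 /= => -> _; rewrite permK.
  by case: eqP => [-> _|//]; apply: val_inj; rewrite /= s1 clock_down clock_up.
exists unfetch => [|n s]; first exact: can_inj unfetchK.
split=> h j jn.
  have := h 1%N isT; rewrite /unstep w1; case: ifPn => [s1 /(congr1 val)|].
    rewrite /= clock_down => e; have := ltn_ord (s 1%N).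
    have s1' : (0 < s 1%N)%N by rewrite lt0n -val_eqE /= in s1 *.
    by rewrite -(prednK s1') e ltnn.
  rewrite negbK => /eqP s1 _; rewrite /step w1 eqxx /= unfetchK.
  have := h j jn; rewrite /unstep s1 eqxx /=; case: eqP => [-> _|j1 <-]; first by [].
  by rewrite unfetch_eq1; case: eqP j1.
have s1 := h 1%N isT; rewrite /step w1 eqxx /= in s1.
have := h j jn; rewrite /unstep s1 eqxx /=; case: eqP => [->//|j1 ->].
by rewrite /step w1 eqxx /= unfetchK unfetch_eq1; case: eqP j1.
Qed.

Lemma iter_step_run s u : (u + s 1%N <= M)%N ->
  [/\ iter u step s 0%N = (p ^+ u)%g (s 0%N), iter u step s 1%N = (u + s 1%N)%N :> nat &
      forall j, (1 < j)%N -> iter u step s j = s j].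
Proof.
elim: u => [|u IHu] uM; first by rewrite expg0 perm1.
have [i0 i1 ij] := IHu (ltnW uM).
have nmax : iter u step s 1%N != ord_max.
  by rewrite -val_eqE /= i1 ltn_eqF.
rewrite iterS /step nmax /=; split=> //.
- by rewrite i0 expgSr permM.
- by rewrite clock_up// i1.
- by move=> [|[|j]]// _; exact: ij.
Qed.

(** The clock reaches its last value after [M - s 1] steps without touching the digits beyond it;
    one more step resets it and shifts the even places. *)
Lemma iter_step_reset s :
  iter (b - s 1%N) step s 1%N = ord0 /\ forall j, iter (b - s 1%N) step s j.*2 = s j.+1.*2.
Proof.
have sM : (s 1%N <= M)%N by rewrite -ltnS.
have [|_ i1 ij] := @iter_step_run s (M - s 1%N); first by rewrite subnK.
rewrite subSn// iterS.
have -> : step (iter (M - s 1%N) step s) = fun j => if j == 1 then ord0 else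
    iter (M - s 1%N) step s (fetch j).
  apply/funext => j; rewrite {1}/step ifF//; apply/negbTE; rewrite negbK.
  by apply/eqP/val_inj; rewrite /= i1 subnK.
split=> //= j; rewrite ifF; last by lia.
by rewrite /fetch odd_double ij.
Qed.

Lemma iter_step_blocks s i :
  iter (b - s 1%N + i * b) step s 1%N = ord0 /\
  forall j, iter (b - s 1%N + i * b) step s j.*2 = s (i + j.+1)%N.*2.
Proof.
elim: i => [|i [IH1 IH2]]; first by rewrite addn0; exact: iter_step_reset.
rewrite mulSn addnCA iterD; set r := iter _ step s.
have r1 : r 1%N = ord0 by [].
have := iter_step_reset r; rewrite r1 subn0 => -[-> h]; split=> // j.
by rewrite h /r IH2 addSnnS.
Qed.

(** Block [i] follows the orbit under [p] of one digit of the initial point, at an even place of its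
    own. Different blocks thus depend on different digits, which makes them independent. *)
Lemma iter_step_code s i u : (u < b)%N ->
  iter (b - s 1%N + i * b + u) step s 0%N = (p ^+ u)%g (s i.+1.*2).
Proof.
move=> ub; rewrite addnC iterD; set r := iter _ step s.
have [r1 r0] := iter_step_blocks s i; rewrite -/r in r1 r0.
have [|-> _ _] := @iter_step_run r u; first by rewrite r1 addn0 -ltnS.
by rewrite (r0 0%N) addn1.
Qed.

End step.

(** * Codes of the step map *)

Section step_autom.
Variables (R : realType) (M : nat) (p : {perm 'I_M.+1}).
Hypothesis M0 : (0 < M)%N.
Implicit Types (x : R) (s w : nat -> 'I_M.+1).
Local Notation b := M.+1.
Local Notation dig := (@dig R M).

Let cyl (G : (nat -> 'I_b) -> nat -> 'I_b) n w : set R :=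
  [set x | U01 x /\ forall j, (j < n)%N -> G (dig x) j = w j].

Let bX n : 0 < (b ^ n)%:R :> R.
Proof. by rewrite ltr0n expn_gt0. Qed.

(** Summing over the [b] values of digit [n] reaches the lengths 0 and 1, which are too short to
    prescribe the clock. *)
Let cyl_down G n :
  (forall w, meas01 (cyl G n.+1 w) /\ vol (cyl G n.+1 w) = ((b ^ n.+1)%:R)^-1) ->
  forall w, meas01 (cyl G n w) /\ vol (cyl G n w) = ((b ^ n)%:R)^-1.
Proof.
move=> h w; pose wa (a : 'I_b) j := if j == n then a else w j.
have E a : cyl G n w `&` (fun x => G (dig x) n) @^-1` [set a] = cyl G n.+1 (wa a).
  apply/seteqP; split=> x /=.
    move=> [[Ux hw] hn]; split=> // j; rewrite ltnS leq_eqVlt /wa.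
    by case: eqP => [->//|_ /= /hw].
  move=> [Ux hw]; split; last by rewrite hw// /wa eqxx.
  by split=> // j jn; rewrite hw ?ltnS 1?ltnW// /wa ltn_eqF.
have [a|a|] := @vol_label_const R _ (fun x => G (dig x) n) (cyl G n w)
  ((b ^ n.+1)%:R)^-1 predT; [by rewrite E; case: (h (wa a))..|].
rewrite (_ : [set x | _] = cyl G n w); last first.
  by apply/seteqP; split=> x; [case|].
move=> mc ->; split=> //.
by rewrite card_ord expnS natrM invfM mulrA divff ?mul1r// pnatr_eq0.
Qed.

Let cyl_all G G' :
  (forall w, exists2 k, injective k & forall n s,
  (forall j, (j < n.+2)%N -> G s j = w j) <->
  (forall j, (j < n.+2)%N -> s (k j) = G' w (k j))) ->
  forall n w, meas01 (cyl G n w) /\ vol (cyl G n w) = ((b ^ n)%:R)^-1.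
Proof.
move=> h; have h2 n w : meas01 (cyl G n.+2 w) /\ vol (cyl G n.+2 w) = ((b ^ n.+2)%:R)^-1.
  have [k kinj hk] := h w.
  have [|] := @vol_cylinder R M k n.+2 (fun j => G' w (k j)).
    by move=> i j _ _ /kinj.
  rewrite (_ : [set x | _] = cyl G n.+2 w)//.
  by apply/seteqP; split=> x /= [Ux hx]; split=> //; exact/hk.
case=> [|[|n]] w; last exact: h2.
  by do 2!apply: cyl_down => ?; exact: h2.
by apply: cyl_down => ?; exact: h2.
Qed.

Lemma is_autom_step : is_autom (@digit_map R M (step p)).
Proof.
have h1 := cyl_all (@step_cylinder M p).
have h2 := cyl_all (@unstep_cylinder M p).
apply: (@is_autom_digit_map R M M0 (step p) (unstep p)).
- exact: step_unsat.
- exact: unstep_unsat.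
- exact: stepK.
- exact: unstepK.
- by move=> n s; case: (h1 n s).
- by move=> n s; case: (h2 n s).
- by move=> n s; case: (h1 n s).
Qed.

Local Notation S := (@digit_map R M (step p)).

Lemma iter_step_in x t :
  U01 x -> U01 (iter t S x) /\ dig (iter t S x) = iter t (step p) (dig x).
Proof.
move=> Ux; elim: t => //= t [IH1 IH2]; split.
  by apply: digit_map_in => //; exact: step_unsat.
by rewrite dig_digit_map// ?IH2//; exact: step_unsat.
Qed.

Variable h : nat.
Hypothesis bh : b = h.*2.

(** The base is even, so 1/2 is an endpoint of cells and the first digit decides. *)
Lemma lt_half_dig x : U01 x -> (x < 2^-1) = (dig x 0%N < h)%N.
Proof.
move=> Ux; have /andP[x0 x1] := Ux.
rewrite /dig inordK ?ltn_mod// expn1 modn_small ?cell_lt//.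
rewrite truncn_lt_nat ?mulr_ge0// bh -muln2 natrM.
have h0 : 0 < h%:R :> R by rewrite ltr0n; lia.
by rewrite -mulrA gtr_pMr// -[in RHS](ltr_pM2l (_ :
  0 < 2^-1 :> R)) ?invr_gt0// mulKf// mulr1.
Qed.

Lemma miss_step (w : nat -> bool) n x : U01 x ->
  code_miss S w n x = (\sum_(t < n) ((iter t (step p) (dig x) 0 < h)%N != w t))%N.
Proof.
move=> Ux; apply: eq_bigr => t _; have [h1 h2] := iter_step_in t Ux.
by rewrite lt_half_dig// h2.
Qed.

(** Disagreements with [w] in the block that starts at time [t0] from position [i]. *)
Definition block_miss (w : nat -> bool) t0 (i : 'I_b) : nat :=
  (\sum_(u < b) (((p ^+ u)%g i < h)%N != w (t0 + u)))%N.

(** At each time [p ^+ u] permutes the positions, so exactly [h] of them are in the lower half and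
    [h] in the upper one; whichever letter [w] has there, [h] positions disagree. *)
Lemma sum_block_miss (w : nat -> bool) t0 : (\sum_(i < b) block_miss w t0 i = b * h)%N.
Proof.
rewrite exchange_big /= (eq_bigr (fun=> h)) ?sum_nat_const ?card_ord// => u _.
rewrite (reindex_inj (@perm_inj _ ((p ^+ u)^-1)%g)) /=.
under eq_bigr do rewrite -permM mulVg perm1.
have half : (\sum_(i < b) (i < h)%N = h)%N.
  rewrite -(big_mkord xpredT (fun i => nat_of_bool (i < h)%N)) bh -addnn.
  rewrite (big_cat_nat (n := h)) ?leq_addr//=.
  rewrite big_nat_cond (eq_bigr (fun=> 1%N)) => [|i /andP[/andP[_ ->]]//].
  rewrite -big_nat_cond sum_nat_const_nat subn0 muln1.
  rewrite big_nat_cond big1 ?addn0// => i /andP[/andP[hi _] _].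
  by rewrite ltnNge hi.
case: (w _); last by under eq_bigr do rewrite eqbF_neg negbK; exact: half.
have : (\sum_(i < b) (i < h)%N + \sum_(i < b) ((i < h)%N != true) = b)%N.
  rewrite -big_split /= (eq_bigr (fun=> 1%N)) ?sum_nat_const ?card_ord ?muln1// => i _.
  by case: (i < h)%N.
by rewrite half [in RHS]bh -addnn => /addnI.
Qed.

Lemma block_miss_le (w : nat -> bool) t0 i : (block_miss w t0 i <= b)%N.
Proof.
apply: (@leq_trans (\sum_(u < b) 1)%N); last by rewrite sum_nat_const card_ord muln1.
by apply: leq_sum => u _; case: (_ != _).
Qed.

(** Whatever the initial clock, the window of length [m.+1 * b] contains [m] complete blocks; the
    incomplete pieces before and after them are dropped. *)
Lemma miss_blocks (w : nat -> bool) m x : U01 x ->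
  (\sum_(j < m) block_miss w (b - dig x 1%N + j * b) (dig x j.+1.*2) <=
   code_miss S w (m.+1 * b) x)%N.
Proof.
move=> Ux; rewrite miss_step//; set s := dig x; set c := s 1%N.
pose e t : nat := ((iter t (step p) s 0%N < h)%N != w t).
rewrite -(big_mkord xpredT e).
have cb : (c < b)%N by [].
have -> : (\sum_(j < m) block_miss w (b - c + j * b) (s j.+1.*2) =
    \sum_(b - c <= t < b - c + m * b) e t)%N.
  elim: m => [|m IHm]; first by rewrite big_ord0 addn0 big_geq.
  rewrite big_ord_recr IHm /= [RHS](@big_cat_nat _ _ _ (b - c + m * b)) ?leq_addr//=;
    last first.
    by rewrite mulSn; lia.
  congr (_ + _)%N; rewrite (_ : b - c + m.+1 * b = b - c + m * b + b)%N; last first.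
    by rewrite mulSn; lia.
  rewrite -[X in _ = (\sum_(X <= _ < _) _)%N]add0n big_addn addKn big_mkord.
  by apply: eq_bigr => u _; rewrite /e [(u + _)%N]addnC iter_step_code.
rewrite [leqRHS](@big_cat_nat _ _ _ (b - c)) //=; last by rewrite mulSn; lia.
rewrite (@big_cat_nat _ _ _ (b - c + m * b) (b - c) (m.+1 * b)) ?leq_addr//=; last first.
  by rewrite mulSn; lia.
by rewrite addnCA leq_addr.
Qed.

(** As [expR y >= 1 + y], it is enough that [(1 + y) * (1 - y / 2) >= 1], that is,
    [y * (1 - y) >= 0]. *)
Lemma expRN_le (y : R) : 0 <= y <= 1 -> expR (- y) <= 1 - y / 2.
Proof.
move=> /andP[y0 y1]; rewrite expRN invf_ple ?posrE ?expR_gt0//; last by lra.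
apply: le_trans (expR_ge1Dx y); rewrite invf_ple ?posrE; [|lra|lra].
rewrite -[X in X <= _]mul1r ler_pdivrMr; last by lra.
have : 0 <= y * (1 - y) by apply: mulr_ge0; lra.
by nra.
Qed.

(** A block has on average a proportion 1/2 of disagreements, and the linear bound on the
    exponential turns this into an average of at most 1 - 1/4. *)
Lemma sum_expR_block (w : nat -> bool) t0 :
  \sum_(i < b) expR (- ((block_miss w t0 i)%:R / b%:R) : R) <= 3 / 4 * b%:R.
Proof.
have b0 : 0 < b%:R :> R by rewrite ltr0n.
apply: (@le_trans _ _ (\sum_(i < b) (1 - (block_miss w t0 i)%:R / b%:R / 2))).
  apply: ler_sum => i _; apply: expRN_le.
  by rewrite divr_ge0//= ler_pdivrMr// mul1r ler_nat block_miss_le.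
rewrite sumrB sumr_const card_ord -!mulr_suml -natr_sum sum_block_miss natrM.
rewrite [b%:R * h%:R]mulrC mulfK ?gt_eqF//.
have -> : h%:R = b%:R / 2 :> R by rewrite bh -muln2 natrM mulfK.
by rewrite le_eqVlt; apply/orP; left; apply/eqP; field.
Qed.

(** The initial digits of the blocks for which, with initial clock [c], the complete blocks alone do
    not exclude the ball around [w]. *)
Let bad (w : nat -> bool) m (c : 'I_b) : pred {ffun 'I_m -> 'I_b} :=
  [pred g : {ffun 'I_m -> 'I_b} |
    8 * (\sum_(j < m) block_miss w (b - c + j * b) (g j)) <= m.+1 * b]%N.

(** Exponential Markov inequality: each bad [g] contributes at least 1 to the sum over all [g], and
    that sum factors over the blocks. *)
Let card_bad (w : nat -> bool) m (c : 'I_b) :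
  #|@bad w m c|%:R <= expR (m.+1%:R / 8) * (3 / 4 * b%:R) ^+ m :> R.
Proof.
have b0 : 0 < b%:R :> R by rewrite ltr0n.
pose E (j : 'I_m) (i : 'I_b) : R :=
  expR (- ((block_miss w (b - c + j * b) i)%:R / b%:R)).
apply: (@le_trans _ _ (\sum_(g : {ffun 'I_m -> 'I_b})
    expR (m.+1%:R / 8) * \prod_(j < m) E j (g j))).
  rewrite -sum1_card natr_sum [leRHS](bigID (@bad w m c)) /= -[leLHS]addr0 lerD//.
    apply: ler_sum => g /= gbad; rewrite /E -expR_sum -expRD -[leLHS]expR0 ler_expR.
    rewrite sumrN subr_ge0 -mulr_suml -natr_sum ler_pdivrMr// mulrAC ler_pdivlMr//.
    by rewrite -!natrM ler_nat mulnC.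
  apply: sumr_ge0 => g _; rewrite mulr_ge0 ?expR_ge0// prodr_ge0// => j _.
  exact: expR_ge0.
rewrite -mulr_sumr ler_pM2l ?expR_gt0// -(bigA_distr_bigA E) /=.
rewrite -[m in X in _ <= X](card_ord m) -prodr_const; apply: ler_prod => j _.
by rewrite sumr_ge0 ?sum_expR_block// => i _; exact: expR_ge0.
Qed.

Lemma vol_code_ball_step (w : nat -> bool) m :
  vol (code_ball S w (m.+1 * b)) <= expR (m.+1%:R / 8) * (3 / 4) ^+ m.
Proof.
have b0 : 0 < b%:R :> R by rewrite ltr0n.
pose J := ('I_b * {ffun 'I_m -> 'I_b})%type.
(* The places read by the first [m] complete blocks: the clock, then the even places from 2 to
   [2 * m]. *)
pose k j : nat := if j is j'.+1 then j'.+1.*2 else 1%N.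
pose s (cg : J) j : 'I_b := if j is j'.+1 then odflt ord0 (omap cg.2 (insub j')) else cg.1.
pose C (cg : J) := [set x : R | U01 x /\ forall j, (j < m.+1)%N -> dig x (k j) = s cg j].
have kinj : forall i j, (i < m.+1)%N -> (j < m.+1)%N -> k i = k j -> i = j.
  by move=> [|i] [|j] _ _ //=; lia.
have hC cg : meas01 (C cg) /\ vol (C cg) = ((b ^ m.+1)%:R)^-1.
  exact: (@vol_cylinder R M k m.+1 (s cg) kinj).
have mB : meas01 (code_ball S w (m.+1 * b)) by apply: meas01_code_ball;
  exact: is_autom_step.
have mU : meas01 (@U01 R) by apply: meas01W; exact: measurable_U01.
rewrite vol_U01//.
apply: (@le_trans _ _ (\sum_(cg : J | @bad w m cg.1 cg.2) vol (C cg))).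
  apply: vol_sum_le_fin; [exact: meas01I|by move=> cg _; case: (hC cg)|].
  move=> x _ [Ux xB].
  exists (dig x 1%N, [ffun j : 'I_m => dig x j.+1.*2]).
    rewrite /bad /=; apply: leq_trans xB; rewrite leq_mul2l /=.
    apply: leq_trans (miss_blocks w m Ux); apply: leq_sum => j _.
    by rewrite ffunE.
  split=> // -[|j] //= jm; rewrite insubT /= ffunE.
  by [].
rewrite (eq_bigr (fun=> ((b ^ m.+1)%:R)^-1)) => [|cg _]; last by case: (hC cg).
rewrite (eq_bigl (fun cg : J => predT cg.1 && @bad w m cg.1 cg.2))//.
rewrite -(pair_big_dep predT (@bad w m) (fun _ _ => ((b ^ m.+1)%:R)^-1)) /=.
apply: (@le_trans _ _ (\sum_(c < b) expR (m.+1%:R / 8) * (3 / 4 * b%:R) ^+ m / (b ^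
  m.+1)%:R)).
  apply: ler_sum => c _; rewrite sumr_const -[_ *+ _]mulr_natl ler_pM2r ?invr_gt0//.
  exact: card_bad.
rewrite sumr_const card_ord -[_ *+ b]mulr_natl exprMn natrX exprS.
have bm : b%:R ^+ m != 0 :> R by rewrite expf_neq0// gt_eqF.
by rewrite le_eqVlt; apply/orP; left; apply/eqP; field; rewrite bm gt_eqF.
Qed.

(** Since [expR (1 / 8) <= 8 / 7], each block costs a factor [8 / 7 * (3 / 4) = 6 / 7]. For
    [m = 2 * k], Bernoulli's inequality gives a decay of order [36 / k ^ 2], which beats the linear
    growth of the length. *)
Lemma vol_code_ball_step_small (e : R) : 0 < e -> exists n, forall w : nat -> bool,
  vol (code_ball S w n) * n.+1%:R <= e.
Proof.
move=> e0.
have b0 : 0 < b%:R :> R by rewrite ltr0n.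
have b1 : 1 <= b%:R :> R by rewrite ler1n.
(* The number 200 exceeds [8 / 7 * 36 * 4], the product of the constants in [h2], [h3] and [h4]. *)
have [k ke] : exists k, 200 * b%:R / e < k%:R :> R.
  by exists (Num.truncn (200 * b%:R / e)).+1; exact: truncnS_gt.
have kb : 200 * b%:R < k%:R * e by rewrite -ltr_pdivrMr.
have k0 : 1 <= k%:R :> R.
  rewrite ler1n -(ltr_nat R); apply: le_lt_trans ke.
  by rewrite divr_ge0 ?mulr_ge0// ltW.
pose m := (k + k)%N; exists (m.+1 * b)%N => w.
have bern : 1 + k%:R / 6 <= (7 / 6) ^+ k :> R.
  elim: (k) => [|i IHi]; first by rewrite mul0r addr0 expr0.
  rewrite exprS -[i.+1%:R]natr1; have i0 : 0 <= i%:R :> R by [].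
  apply: (@le_trans _ _ (7 / 6 * (1 + i%:R / 6))); first by nra.
  by rewrite ler_pM2l//; lra.
have exp8 : expR (m.+1%:R / 8) <= (8 / 7) ^+ m.+1 :> R.
  rewrite mulr_natl -[_ *+ _]mulr_natl expRM_natl.
  apply: lerXn2r; rewrite ?nnegrE ?expR_ge0//.
  have h78 : 7 / 8 <= expR (- 8^-1) :> R by apply: le_trans (expR_ge1Dx _); lra.
  rewrite -[X in expR X]opprK expRN (_ : 8 / 7 = (7 / 8)^-1) ?lef_pV2 ?posrE ?expR_gt0//.
  by field.
have h1 := vol_code_ball_step w m.
have h2 : vol (code_ball S w (m.+1 * b)) <= 8 / 7 * (6 / 7) ^+ m.
  apply: (le_trans h1); apply: (@le_trans _ _ ((8 / 7) ^+ m.+1 * (3 / 4) ^+ m)).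
    by rewrite ler_pM2r// exprn_gt0//; lra.
  rewrite exprS -mulrA -exprMn (_ : 8 / 7 * (3 / 4) = 6 / 7 :> R)//; by field.
have h3 : (6 / 7) ^+ m * (k%:R ^+ 2 / 36) <= 1 :> R.
  have -> : (6 / 7) ^+ m = ((7 / 6) ^+ k ^+ 2)^-1 :> R.
    rewrite -exprM muln2 -addnn -/m -exprVn; congr (_ ^+ m); by field.
  have q2 : 0 < (7 / 6) ^+ k ^+ 2 :> R by rewrite !exprn_gt0.
  rewrite mulrC ler_pdivrMr// mul1r.
  apply: (@le_trans _ _ ((1 + k%:R / 6) ^+ 2)); first by nra.
  by apply: lerXn2r; rewrite ?nnegrE ?exprn_ge0//; lra.
have h4 : (m.+1 * b).+1%:R <= 4 * k%:R * b%:R :> R.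
  rewrite -natr1 natrM -natr1 /m natrD.
  have : 0 <= (k%:R - 1) * (b%:R - 1) :> R by rewrite mulr_ge0// subr_ge0.
  nra.
have q0 : 0 <= (6 / 7) ^+ m :> R by rewrite exprn_ge0//; lra.
apply: (@le_trans _ _ (8 / 7 * (6 / 7) ^+ m * (4 * k%:R * b%:R))).
  by apply: ler_pM => //; exact: vol_ge0.
set q := (6 / 7) ^+ m in h3 q0 *.
have h5 : q * k%:R ^+ 2 * e <= 36 * e by rewrite ler_pM2r//; lra.
have h6 : 0 <= k%:R * q * (k%:R * e - 200 * b%:R) :> R.
  by rewrite mulr_ge0 ?mulr_ge0// subr_ge0 ltW.
have e1 : k%:R * q * (k%:R * e - 200 * b%:R) = q * k%:R ^+ 2 * e - 200 * (q * k%:R * b%:R).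
  by ring.
have -> : 8 / 7 * q * (4 * k%:R * b%:R) = 32 / 7 * (q * k%:R * b%:R) by ring.
by rewrite e1 in h6; lra.
Qed.

End step_autom.

(** * Approximation by permutations of cells *)

Section matching.
Variables (X Q : finType) (u v : X -> Q).

(* a permutation with the fewest mismatches cannot be improved by a transposition *)
Lemma perm_match : exists s : {perm X},
  (#|[pred x | v (s x) != u x]| <=
   \sum_a (#|[pred x | u x == a]| - #|[pred x | v x == a]|))%N.
Proof.
pose good (s : {perm X}) := #|[pred x | v (s x) == u x]|.
case: (@arg_maxnP _ (1%g : {perm X}) xpredT good isT) => s _ smax; exists s.
rewrite -sum1_card (partition_big u predT) //=; apply: leq_sum => a _.
pose B := [pred x | (v (s x) != u x) && (u x == a)].
rewrite sum1_card (eq_card (B := B)) => [|x]; last by [].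
have [/existsP[x0 /andP[vx0 ux0]]|noB] := boolP [exists x, x \in B]; last first.
  by rewrite eq_card0// => x; apply/negbTE; apply: contra noB => Bx; apply/existsP;
    exists x.
have vu x : v (s x) == a -> u x == a.
  move=> vx; apply: contraT => ux.
  have x0x : x0 != x by apply: contraNneq ux => <-.
  pose s' := (tperm x0 x * s)%g.
  have : (good s < good s')%N.
    apply: proper_card; apply/properP; split; last first.
      by exists x0; rewrite !inE ?(negbTE vx0)// /s' permM tpermL (eqP vx) (eqP ux0).
    apply/fintype.subsetP => y; rewrite !inE /s' permM => gy.
    case: tpermP => [ey|ey|//]; rewrite ey in gy *.
      by rewrite gy in vx0.
    by move: gy ux; rewrite (eqP vx) eq_sym => ->.
  by move=> gs; have := smax s' isT; rewrite /geq /= leqNgt gs.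
have cv : #|[pred x | v (s x) == a]| = #|[pred x | v x == a]|.
  rewrite -(fintype.card_image (@perm_inj _ s) [pred x | v (s x) == a]).
  apply: eq_card => y; apply/fintype.imageP/idP => [[x vx ->]//|vy].
  by exists (s^-1 y)%g; rewrite ?inE permKV.
rewrite -cv -(cardID [pred x | v (s x) == a] [pred x | u x == a]).
have -> : #|[predI [pred x | u x == a] & [pred x | v (s x) == a]]| =
    #|[pred x | v (s x) == a]|.
  apply: eq_card => x; rewrite !inE.
  by case: (boolP (v (s x) == a)) => [/vu ->//|]; rewrite ?andbF.
rewrite addKn; apply: subset_leq_card; apply/fintype.subsetP => x; rewrite !inE.
by move=> /andP[vux /eqP <-]; rewrite vux eqxx.
Qed.
End matching.

(** * Approximation of measurable sets by unions of cells *)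

Section approximation.
Variable R : realType.
Implicit Types (X Y Z A : set R).

Definition cells (N : nat) (V : pred nat) : set R := [set x | U01 x /\ V (cell N x)].

Lemma meas01_cells N V : (0 < N)%N -> meas01 (cells N V).
Proof. by move=> N0; case: (@vol_cells R N V N0). Qed.

Lemma volY_triangle X Y Z : meas01 X -> meas01 Y -> meas01 Z ->
  vol (X `+` Z) <= vol (X `+` Y) + vol (Y `+` Z).
Proof.
move=> mX mY mZ; apply: vol_leU; do ?exact: meas01Y.
move=> x _ /= [[Xx Zx]|[Zx Xx]]; have [Yx|Yx] := pselect (Y x).
- by right; left.
- by left; left.
- by left; right.
- by right; right.
Qed.

Lemma volY_sym X Y : vol (X `+` Y) = vol (Y `+` X).
Proof. by apply: vol_ext => x _; split=> -[|]; [right|left|right|left]. Qed.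

Lemma meas01_atom n (Z : 'I_n -> set R) (a : 'I_n -> Prop) :
  (forall j, meas01 (Z j)) -> meas01 [set x | forall j, Z j x <-> a j].
Proof.
move=> mZ; pose F j := if `[< a j >] then ~` Z j else Z j.
have FE j x : F j x <-> ~ (Z j x <-> a j).
  by rewrite /F; case: asboolP => aj /=; have [|] := pselect (Z j x); tauto.
apply: (@meas01_ext _ (~` [set x | exists2 j, xpredT j & F j x])).
  move=> x _ /=; split=> [h j|h [j _ /FE]//].
  by apply: contrapT => /FE Fj; apply: h; exists j.
apply: meas01C; apply: meas01_ex => j _; rewrite /F; case: ifP => _ //; exact: meas01C.
Qed.

(** A point in one atom but not in the other lies in some [X j] and not in [Y j], or the reverse. *)
Lemma vol_atoms n (X Y : 'I_n -> set R) (a : 'I_n -> Prop) :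
  (forall j, meas01 (X j)) -> (forall j, meas01 (Y j)) ->
  vol [set x | forall j, X j x <-> a j] <=
  vol [set x | forall j, Y j x <-> a j] + \sum_(j < n) vol (X j `+` Y j).
Proof.
move=> mX mY.
have mD j : meas01 (X j `+` Y j) by exact: meas01Y.
apply: (@le_trans _ _ (vol [set x | forall j, Y j x <-> a j] +
    vol [set x | exists2 j, xpredT j & (X j `+` Y j) x])).
  apply: vol_leU; [exact: meas01_atom|exact: meas01_atom|exact: meas01_ex|].
  move=> x _ /= Xa; have [Ya|] := pselect (forall j, Y j x <-> a j); first by left.
  move=> /existsNP[j Yj]; right; exists j => //.
  have := Xa j; rewrite /setY /=; have [|] := pselect (X j x); have [|] := pselect (Y j x);
    tauto.
by rewrite lerD2l; apply: vol_sum_le_fin => //; exact: meas01_ex.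
Qed.

(** Take [K] compact inside [A] and [U] open around it, both close in measure. All cells that are
    short enough and meet [K] stay inside [U]. *)
Lemma approx_cells A (e : R) : measurable A -> A `<=` I01 -> 0 < e ->
  exists N0, forall N, (N0 <= N)%N -> exists V, vol (A `+` cells N V) <= e.
Proof.
move=> mA AI e0.
have e20 : 0 < e / 2 by lra.
have finA : (lebesgue_measure A < +oo)%E by rewrite (lebesgue_vol mA AI) ltry.
have [K [cK KA eK]] := lebesgue_regularity_inner mA finA e20.
have [U [oU AU eU]] := lebesgue_regularity_outer mA finA e20.
(* By compactness one radius serves for all points of [K]. *)
have : \forall n \near \oo, K `<=` [set x | forall y, `|x - y| < n.+1%:R^-1 -> U y].
  move: cK => /compact_near_coveringP; apply => x Kx.
  have /nbhs_ballP[r /= r0 rU] : nbhs x U by apply: open_nbhs_nbhs; split=> //; exact/AU/KA.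
  have r20 : 0 < r / 2 by lra.
  near=> x' n => y x'y.
  apply: rU; rewrite /ball /=.
  have xx' : `|x - x'| < r / 2 by near: x'; exact: nbhsx_ballx.
  have nr : n.+1%:R^-1 < r / 2.
    near: n; exact: near_infty_natSinv_lt (PosNum r20).
  rewrite (_ : x - y = (x - x') + (x' - y)); last by ring.
  rewrite (le_lt_trans (ler_normD _ _))// [ltRHS]splitr; apply: ltrD => //.
  exact: lt_trans x'y nr.
move=> [N0 _ KU]; exists N0.+1 => N NN0.
have N_gt0 : (0 < N)%N by exact: leq_ltn_trans NN0.
(* The cells that meet [K]. *)
pose V v := `[< exists2 x, K x /\ U01 x & cell N x = v >].
exists V.
have mK : measurable K by exact: compact_measurable.
have mU : measurable U by exact: open_measurable.
have VU x : cells N V x -> U x.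
  move=> [Ux /asboolP[z [Kz Uz] zx]].
  have := KU N.-1; rewrite /= prednK// => /(_ _ z Kz x); apply;
    first by rewrite -ltnS prednK.
  have N0' : 0 < N%:R :> R by rewrite ltr0n.
  have : cell N z == cell N x by rewrite zx.
  have : cell N x == cell N x by [].
  case/andP: Ux => Ux0 _; case/andP: Uz => Uz0 _.
  rewrite !cellP// => /andP[h1 h2] /andP[h3 h4].
  have h5 : (cell N x).+1%:R / N%:R = (cell N x)%:R / N%:R + N%:R^-1 :> R.
    by rewrite -natr1 mulrDl mul1r.
  by rewrite h5 in h2 h4; rewrite ltr_norml; apply/andP; split; lra.
have h1 : vol (A `\` K) < e / 2.
  rewrite -lte_fin -lebesgue_vol//; first exact: measurableD.
  by move=> x [/AI].
have h2 : vol (U `\` A) < e / 2.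
  have mUA : measurable (U `\` A) by exact: measurableD.
  rewrite -lte_fin -leb_on_vol; last exact: meas01W.
  apply: le_lt_trans eU; rewrite leb_onE; apply: le_measure; rewrite ?inE//.
  exact: meas01W.
have mAK : meas01 (A `\` K) by apply: meas01W; exact: measurableD.
have mUA : meas01 (U `\` A) by apply: meas01W; exact: measurableD.
have mC := meas01_cells V N_gt0.
have mA' : meas01 A by exact: meas01W.
apply: (@le_trans _ _ (vol (A `\` K) + vol (U `\` A))); last by lra.
rewrite (vol_U01 (meas01Y mA' mC)).
apply: vol_leU => //.
  by apply: meas01I; [apply: meas01W; exact: measurable_U01|exact: meas01Y].
move=> x Ix /= [Ux [[Ax Cx]|[/VU Vx Ax]]]; last by right.
left; split=> // Kx; apply: Cx; split=> //; apply/asboolP.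
by exists x.
Unshelve. all: by end_near.
Qed.

End approximation.

(** * Density of the step maps *)

Section density.
Variable R : realType.
Implicit Types (f g : R -> R) (X Y A : set R).

(** Divided by [b], the two counts are measures of atoms of the cell sets. They are within [n * eta]
    of the measures of the corresponding atoms of [X] and of [Y], which are equal. *)
Lemma card_atom_le (b n : nat) (X Y : 'I_n -> set R) (V W : 'I_n -> pred nat) (eta : R)
    (a : {ffun 'I_n -> bool}) :
  (0 < b)%N -> (forall j, meas01 (X j)) -> (forall j, meas01 (Y j)) ->
  (forall j, vol (X j `+` cells b (V j)) <= eta) ->
  (forall j, vol (Y j `+` cells b (W j)) <= eta) ->
  vol [set x | forall j, X j x <-> a j] = vol [set x | forall j, Y j x <-> a j] ->
  (#|[pred i : 'I_b | [ffun j => V j i] == a]| - #|[pred i :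
    'I_b | [ffun j => W j i] == a]|)%:R
    <= 2 * n%:R * eta * b%:R :> R.
Proof.
move=> b0 mX mY eX eY XY; have b0' : 0 < b%:R :> R by rewrite ltr0n.
have atomE (Z : 'I_n -> pred nat) : vol [set x : R | forall j, cells b (Z j) x <-> a j] =
    #|[pred i : 'I_b | [ffun j => Z j i] == a]|%:R / b%:R.
  have [_ e] := @vol_cells R b (fun i => [ffun j => Z j i] == a) b0.
  apply: (etrans _ e).
  rewrite vol_U01; last by apply: meas01_atom => j; exact: meas01_cells.
  apply: vol_ext => x _; split=> /= -[Ux h]; split=> //.
    by apply/eqP/ffunP => j; rewrite ffunE; apply/idP/idP => [?|/h []//]; apply/h.
  move=> j; rewrite -(eqP h) ffunE; split=> [[]//|]; by split.
have sumle (Z : 'I_n -> set R) :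
  (forall j, vol (Z j) <= eta) -> \sum_(j < n) vol (Z j) <= n%:R * eta.
  move=> h; apply: (@le_trans _ _ (\sum_(j < n) eta)); first by apply: ler_sum.
  by rewrite sumr_const card_ord mulr_natl.
have h1 := @vol_atoms R n (fun j => cells b (V j)) X (fun j => a j) (fun j =>
  meas01_cells (V j) b0) mX.
have h2 := @vol_atoms R n Y (fun j => cells b (W j)) (fun j => a j) mY (fun j =>
  meas01_cells (W j) b0).
have s1 := sumle (fun j => cells b (V j) `+` X j) (fun j => ltac:(rewrite volY_sym;
  exact: eX)).
have s2 := sumle (fun j => Y j `+` cells b (W j)) eY.
rewrite !atomE /= in h1 h2; rewrite XY in h1.
set u := #|_|; set v := #|_|.
have uv : u%:R / b%:R <= v%:R / b%:R + 2 * n%:R * eta :> R by lra.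
have eta0 : 0 <= n%:R * eta.
  apply: le_trans s2; apply: sumr_ge0 => j _; exact: vol_ge0.
have [uv'|vu] := leqP u v.
  by rewrite (eqP (uv' : (u - v == 0)%N)) mulr_ge0 ?(ltW b0')// -mulrA mulr_ge0.
rewrite natrB; last exact: ltnW.
rewrite -(ler_pM2r b0') mulrDl !divfK ?gt_eqF// in uv; lra.
Qed.

(** The step map permutes the cells by [p] except where the clock digit is the last one, a set of
    measure [1 / b]. *)
Lemma vol_step_cells M (p : {perm 'I_M.+1}) (V W : pred nat) :
  (0 < M)%N ->
  vol (cells M.+1 V `+` digit_map (R := R) (step p) @^-1` cells M.+1 W) <=
  (M.+1%:R)^-1 + #|[pred i : 'I_M.+1 | V i != W (p i)]|%:R / M.+1%:R.
Proof.
move=> M0; have aS := is_autom_step R p M0; set S := digit_map _ in aS *.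
have [mb vb] := @vol_cells R M.+1 (fun i => [exists j :
  'I_M.+1, (j == i :> nat) && (V j != W (p j))]) isT.
have -> : #|[pred i : 'I_M.+1 | V i != W (p i)]| =
   #|[pred i : 'I_M.+1 | [exists j : 'I_M.+1, (j == i :> nat) && (V j != W (p j))]]|.
  apply: eq_card => i; rewrite !inE; apply/idP/existsP => [h|[j /andP[/eqP/val_inj ->]//]].
  by exists i; rewrite eqxx.
rewrite -vb.
have [|mc vc] := @vol_cylinder R M (fun=> 1%N) 1 (fun=> ord_max).
  by move=> [|i] [|j].
rewrite expn1 in vc; rewrite -vc.
have mV : meas01 (cells M.+1 V : set R) := meas01_cells V (ltn0Sn M).
have mW : meas01 (S @^-1` cells M.+1 W) by apply: (meas01_autom aS);
  exact: (meas01_cells W (ltn0Sn M)).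
rewrite vol_U01; last exact: meas01Y.
apply: vol_leU => //.
  by apply: meas01I; [apply: meas01W; exact: measurable_U01|exact: meas01Y].
move=> x _ [Ux VW].
have [x1|x1] := eqVneq (dig M x 1%N) ord_max; first by left; split=> // -[].
right; split=> //; apply/existsP; exists (dig M x 0%N).
have cE y : U01 y -> cell M.+1 y = dig M y 0%N.
  by move=> Uy; rewrite -[in LHS](expn1 M.+1) (cell_vcode M 1 Uy) /= mul0n.
rewrite cE// eqxx /=.
have USx : U01 (S x) by apply: digit_map_in => //; exact: step_unsat.
have S0 : dig M (S x) 0%N = p (dig M x 0%N).
  by rewrite /S dig_digit_map//; [rewrite /step x1|exact: step_unsat].
move: VW; rewrite /cells /setY /= !cE// S0.
by case: (V _); case: (W _) => //= -[[[_ h] nh]|[[_ h] nh]] //; case: nh; split.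
Qed.

(** Colour each cell by the sets [A j] it approximately belongs to, and again by their images under
    [f]. As [f] preserves the measure, the colour classes have nearly equal sizes, so some
    permutation matches the colourings on most cells; its step map then moves each [A j] nearly as
    [f] does. *)
Lemma autom_density f n (A : 'I_n -> set R) (e : R) : is_autom f ->
  (forall j, measurable (A j)) -> (forall j, A j `<=` U01) -> 0 < e ->
  exists g, [/\ is_autom g, forall j, vol (g @` A j `+` f @` A j) < e &
    forall e', 0 < e' -> exists N, forall w : nat -> bool,
      vol (code_ball g w N) * N.+1%:R <= e'].
Proof.
move=> af mA AU e0.
have AI j : A j `<=` I01 by move=> x /AU; exact: U01I.
have mA' j : meas01 (A j) by apply: meas01W.
have mfA j : measurable (f @` A j) by apply: meas01_image.
have fAI j : f @` A j `<=` I01 by apply: image_I01.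
pose q : R := (2 ^ n)%:R; have q0 : 0 < q by rewrite ltr0n expn_gt0.
(* Three terms [eta] pay for approximating [A j], for approximating its image and for the clock; the
   fourth makes the inequality strict. The rest pays for mismatched cells, [2 * n * eta] for each of
   the [q] colours. *)
pose d := 4 + 2 * n%:R * q; have d0 : 0 < d by apply: ltr_pwDl => //;
  rewrite !mulr_ge0// ltW.
pose eta := e / d; have eta0 : 0 < eta by rewrite divr_gt0.
have /choice[N1 hN1] j := approx_cells (mA j) (AI j) eta0.
have /choice[N2 hN2] j := approx_cells (mfA j) (fAI j) eta0.
pose N0 := (\max_(j < n) maxn (N1 j) (N2 j) + Num.truncn eta^-1)%N.
(* An even base, beyond all approximation thresholds and beyond [eta^-1], which makes the clock
   error at most [eta]. *)
have [h [M [bh M0 bN0]]] : exists h M, [/\ M.+1 = h.*2, (0 < M)%N & (N0 < M.+1)%N].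
  by exists N0.+1, N0.+1.*2.-1; split; lia.
have N1b j : (N1 j <= M.+1)%N.
  apply: leq_trans (ltnW bN0); apply: (leq_trans _ (leq_addr _ _)).
  by apply: leq_trans (leq_bigmax j); exact: leq_maxl.
have N2b j : (N2 j <= M.+1)%N.
  apply: leq_trans (ltnW bN0); apply: (leq_trans _ (leq_addr _ _)).
  by apply: leq_trans (leq_bigmax j); exact: leq_maxr.
have beta : (M.+1%:R)^-1 <= eta.
  rewrite invf_ple ?posrE ?ltr0n//; apply: ltW; apply: lt_le_trans (truncnS_gt _) _.
  by rewrite ler_nat; apply: leq_trans bN0; rewrite ltnS leq_addl.
have /choice[V hV] j := hN1 j M.+1 (N1b j).
have /choice[W hW] j := hN2 j M.+1 (N2b j).
pose u (i : 'I_M.+1) := [ffun j : 'I_n => V j i].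
pose v (i : 'I_M.+1) := [ffun j : 'I_n => W j i].
have [p hp] := perm_match u v.
have b0 : 0 < M.+1%:R :> R by rewrite ltr0n.
have bad : #|[pred i | v (p i) != u i]|%:R <= q * (2 * n%:R * eta * M.+1%:R).
  apply: (@le_trans _ _ (\sum_(a : {ffun 'I_n -> bool})
      (#|[pred x | u x == a]| - #|[pred x | v x == a]|)%:R)).
    by rewrite -natr_sum ler_nat.
  apply: (@le_trans _ _ (\sum_(a : {ffun 'I_n -> bool}) 2 * n%:R * eta * M.+1%:R)).
    apply: ler_sum => a _; apply: (card_atom_le (X := A) (Y := fun j => f @` A j)) => //.
      by move=> j; apply: meas01W; exact: mfA.
    rewrite -(@vol_autom _ _ af [set x | forall j, (f @` A j) x <-> a j]); last first.
      by apply: meas01_atom => j; apply: meas01W; exact: mfA.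
    apply: vol_ext => x Ix /=.
    have fA j : (f @` A j) (f x) <-> A j x.
      split=> [[z Az ez]|Ax]; last by exists x.
      by rewrite -(autom_inj af (AI _ _ Az) Ix ez).
    by split=> H k; [exact: (iff_trans (fA k) (H k))|exact:
      (iff_trans (iff_sym (fA k)) (H k))].
  by rewrite sumr_const card_ffun card_bool card_ord /q -[leLHS]mulr_natl.
exists (digit_map (step p)); split; first exact: is_autom_step.
  move=> j; have aS := is_autom_step R p M0; set S := digit_map _ in aS *.
  have mV : meas01 (cells M.+1 (V j) : set R) := meas01_cells (V j) (ltn0Sn M).
  have mW : meas01 (cells M.+1 (W j) : set R) := meas01_cells (W j) (ltn0Sn M).
  have mSW := meas01_autom aS mW.
  have mfA' : meas01 (f @` A j) by apply: meas01W; exact: mfA.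
  have mSfA := meas01_autom aS mfA'.
  rewrite vol_image//.
  have t1 := volY_triangle (mA' j) mV mSfA.
  have t2 := volY_triangle mV mSW mSfA.
  have t3 : vol (S @^-1` cells M.+1 (W j) `+` S @^-1` (f @` A j)) <= eta.
    rewrite (_ : _ `+` _ = S @^-1` (cells M.+1 (W j) `+` f @` A j))//.
    by rewrite (vol_autom aS); [rewrite volY_sym; exact: hW|exact: meas01Y].
  have t4 := vol_step_cells p (V j) (W j) M0; rewrite -/S in t4.
  have t5 : #|[pred i :
    'I_M.+1 | V j i != W j (p i)]|%:R / M.+1%:R <= q * (2 * n%:R * eta) :> R.
    rewrite ler_pdivrMr//; apply: (@le_trans _ _ (#|[pred i | v (p i) != u i]|%:R)).
      rewrite ler_nat; apply: subset_leq_card; apply/fintype.subsetP => i; rewrite !inE.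
      by apply: contra => /eqP/ffunP/(_ j); rewrite !ffunE => ->.
    by move: bad; rewrite !mulrA.
  have sumlt (a a1 a2 a3 a4 a5 a6 c : R) : a <= a1 + a2 -> a2 <= a3 + a4 -> a4 <= eta ->
      a3 <= a5 + a6 -> a6 <= c -> a1 <= eta -> a5 <= eta -> a < 4 * eta + c.
    by move: eta0; lra.
  have -> : e = 4 * eta + q * (2 * n%:R * eta).
    by rewrite -[LHS](divfK (lt0r_neq0 d0)) -/eta /d; ring.
  exact: (sumlt _ _ _ _ _ _ _ _ t1 t2 t3 t4 t5 (hV j) beta).
by move=> e1 e10; exact: (@vol_code_ball_step_small R M p M0 h bh e1 e10).
Qed.

End density.

(** * The generic set *)

Section perturbation.
Variable R : realType.
Implicit Types (f g : R -> R) (X Y A : set R).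

(** The test sets for the weak neighbourhoods below, cut down to [0, 1) as the subbase requires. *)
Definition half_pre f t : set R := U01 `&` [set x | iter t f x < 2^-1].

(** Up to null sets, [f] maps [half_pre f t.+1] onto the points whose [t]-th iterate is below 1/2;
    moving the preimage under [g] forward by [g] compares the two images. *)
Lemma vol_preimageY f g t : is_autom f -> is_autom g ->
  vol ([set x | iter t f (g x) < 2^-1] `+` [set x | iter t.+1 f x < 2^-1]) <=
  vol (g @` half_pre f t.+1 `+` f @` half_pre f t.+1).
Proof.
move=> af ag; set D := [set x | iter t f x < 2^-1].
have mD : meas01 D by exact: (meas01_iter af t (@meas01_half R)).
have mfD := meas01_autom af mD; have mgD := meas01_autom ag mD.
have E : [set x | iter t.+1 f x < 2^-1] = f @^-1` D by apply/seteqP; split=> x;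
  rewrite /= -iterS iterSr.
have EC : half_pre f t.+1 = U01 `&` f @^-1` D by rewrite /half_pre E.
have mU : meas01 (@U01 R) by apply: meas01W; exact: measurable_U01.
have mC : meas01 (half_pre f t.+1) by rewrite EC; exact: meas01I.
have CI : half_pre f t.+1 `<=` I01 by move=> x [/U01I].
have mfC : meas01 (f @` half_pre f t.+1) by apply: meas01W; exact: meas01_image.
have mgC : meas01 (g @` half_pre f t.+1) by apply: meas01W; exact: meas01_image.
have fC0 : vol (f @` half_pre f t.+1 `+` D) = 0.
  rewrite vol_image// vol_U01; last exact: meas01Y.
  rewrite EC -[RHS]vol0; congr vol; apply/seteqP; split=> // x /=.
  by case=> Ux [[[_ ?] ?]|[? nx]] //; apply: nx.
rewrite E (_ : [set x | iter t f (g x) < 2^-1] = g @^-1` D)// volY_sym.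
have -> : vol (f @^-1` D `+` g @^-1` D) = vol (half_pre f t.+1 `+` g @^-1` D).
  rewrite vol_U01; last exact: meas01Y.
  rewrite [RHS]vol_U01; last exact: meas01Y.
  rewrite EC; congr vol; apply/seteqP; split=> x [Ux]; rewrite /setY /=; tauto.
rewrite -vol_image//; apply: le_trans (volY_triangle mgC mfC mD) _.
by rewrite fC0 addr0.
Qed.

(** Replacing [f] by [g] one step at a time shows that letter [t] of the code changes on a set of
    measure at most [t * d]. Outside the union of these [n] sets the two codes agree. *)
Lemma vol_code_ball_perturb f g n (d : R) (w : nat -> bool) : is_autom f -> is_autom g ->
  (forall t, (t < n)%N -> vol (g @` half_pre f t.+1 `+` f @` half_pre f t.+1) <= d) ->
  vol (code_ball g w n) <= vol (code_ball f w n) + n%:R * (n%:R * d).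
Proof.
move=> af ag hd.
pose E (h : R -> R) t : set R := [set x | iter t h x < 2^-1].
have mE h t : is_autom h -> meas01 (E h t) by move=> ah;
  exact: (meas01_iter ah t (@meas01_half R)).
have hE t : (t <= n)%N -> vol (E g t `+` E f t) <= t%:R * d.
  elim: t => [_|t IHt tn].
    rewrite mul0r (_ : _ `+` _ = set0) ?vol0//.
    by apply/seteqP; split=> x // -[[]|[]].
  have m1 : meas01 (E g t.+1) by exact: mE.
  have m2 : meas01 (g @^-1` E f t) by apply: meas01_autom => //; exact: mE.
  have m3 : meas01 (E f t.+1) by exact: mE.
  apply: le_trans (volY_triangle m1 m2 m3) _.
  have -> : E g t.+1 `+` g @^-1` E f t = g @^-1` (E g t `+` E f t).
    have e : E g t.+1 = g @^-1` E g t by apply/seteqP; split=> x;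
      rewrite /E /= -iterS iterSr.
    by rewrite e.
  rewrite (vol_autom ag); last by apply: meas01Y; exact: mE.
  rewrite -natr1 mulrDl mul1r lerD// ?IHt// 1?ltnW//.
  exact: le_trans (vol_preimageY t af ag) (hd t tn).
have mE2 t : meas01 (E g t `+` E f t) by apply: meas01Y; exact: mE.
apply: (@le_trans _ _ (vol (code_ball f w n) + vol [set x | exists2 t :
  'I_n, xpredT t & (E g t `+` E f t) x])).
  apply: vol_leU; [exact: meas01_code_ball|exact: meas01_code_ball|exact: meas01_ex|].
  move=> x _ xg; have [h|/existsNP[t /not_implyP [_ h]]] :=
    pselect (forall t : 'I_n, true -> (iter t g x < 2^-1)%R = (iter t f x < 2^-1)%R).
    left; rewrite /code_ball /code_miss /=.
    under eq_bigr => t _ do rewrite -(h t isT).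
    exact: xg.
  right; exists t => //; move: h; rewrite /setY /E /=.
  case: (iter t g x < _); case: (iter t f x < _) => h;
    by [case: h|left; split|right; split|case: h].
rewrite lerD2l.
apply: (@le_trans _ _ (\sum_(t < n) vol (E g t `+` E f t))).
  by apply: (@vol_sum_le_fin _ _ predT) => //; exact: meas01_ex.
have d0 (t : 'I_n) : 0 <= d.
  by apply: le_trans (hd t (ltn_ord t)); exact: vol_ge0.
apply: (@le_trans _ _ (\sum_(t < n) n%:R * d)).
  apply: ler_sum => t _; apply: le_trans (hE t (ltnW (ltn_ord t))) _.
  by rewrite ler_wpM2r ?(d0 t)// ler_nat ltnW.
by rewrite sumr_const card_ord -[leLHS]mulr_natl.
Qed.

(** It allows passing between a given map and the representative that the quotient chooses for its
    class. *)
Lemma vol_image_ae f g A : is_autom f -> is_autom g ->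
  (f = g %[ae leb_on `[0, 1]]) -> meas01 A -> A `<=` I01 ->
  vol (g @` A `+` f @` A) = 0.
Proof.
move=> af ag fg mA AI.
have mfA : meas01 (f @` A) by apply: meas01W; exact: meas01_image.
rewrite vol_image//; have mgfA := meas01_autom ag mfA.
move: fg => [N [mN N0 NE]].
have vN : vol N = 0 by rewrite /vol N0.
apply/eqP; rewrite eq_le vol_ge0 andbT -vN.
apply: vol_le => //; [exact: meas01Y|exact: meas01W|].
move=> x Ix /= Ax; apply: NE => /= /(_ I) fgx; move: Ax; rewrite /setY /=.
have e : (f @` A) (g x) <-> A x.
  rewrite -fgx; split=> [[z Az ez]|Ax]; last by exists x.
  by rewrite -(autom_inj af (AI _ Az) Ix ez).
by case=> -[] => [Ax []|/e//]; exact/e.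
Qed.

End perturbation.

(** * The weak topology and the generic set *)

Section topology.
Variable R : realType.
Implicit Types (S T : autom R) (A : set R).
Local Open Scope quotient_scope.

Lemma is_autom_fun S : is_autom (autom_fun S).
Proof. exact: preautomP. Qed.

Lemma autom_fun_pi (f : preautom R) :
  autom_fun (\pi_(autom R) f) = f %[ae leb_on `[0, 1]].
Proof.
have : repr (\pi_(autom R) f) = f %[mod autom R] by rewrite reprK.
by move=> /eqmodP /asboolP.
Qed.

Lemma weak_nbhsE S T A (e : R) : measurable A -> A `<=` U01 ->
  weak_nbhs T A e S <-> vol (autom_fun S @` A `+` autom_fun T @` A) < e.
Proof.
move=> mA AU; have AI : A `<=` I01 by move=> x /AU /U01I.
have mA' : meas01 A by exact: meas01W.
have mS := meas01_image (is_autom_fun S) mA' AI.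
have mT := meas01_image (is_autom_fun T) mA' AI.
rewrite /weak_nbhs /= lebesgue_vol ?lte_fin//.
  by apply: measurableU; exact: measurableD.
have SI := image_I01 (is_autom_fun S) AI.
have TI := image_I01 (is_autom_fun T) AI.
by move=> x [[/SI]|[/TI]].
Qed.

Lemma open_weak_nbhs T A (e : R) : measurable A -> A `<=` U01 -> 0 < e ->
  open (weak_nbhs T A e).
Proof.
move=> mA AU e0; exists [set weak_nbhs T A e]; last by rewrite bigcup_set1.
move=> _ ->; apply: (@finI_from1 _ _ (@weak_subbase R) id).
by exists T, A, e; split=> //; rewrite -U01_itv.
Qed.

Lemma open_weak_nbhsP (O : set (autom R)) S : open O -> O S ->
  exists n (T : 'I_n -> autom R) (A : 'I_n -> set R) (e : 'I_n -> R),
    [/\ forall j, measurable (A j), forall j, A j `<=` U01,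
        forall j, weak_nbhs (T j) (A j) (e j) S &
        forall S', (forall j, weak_nbhs (T j) (A j) (e j) S') -> O S'].
Proof.
move=> [D' sD' <-] [B D'B BS]; have [s FD FB] : exists2 s : seq (set (autom R)),
    {subset s <= @weak_subbase R} & \bigcap_(N in [set` s]) N = B.
  by have [F FD FB] := sD' _ D'B; exists (finmap.enum_fset F).
pose n := size s.
have sN (j : 'I_n) : exists TAe : autom R * set R * R,
  [/\ measurable TAe.1.2, TAe.1.2 `<=` U01 & nth set0 s j = weak_nbhs TAe.1.1 TAe.1.2
    TAe.2].
  have jF : nth set0 s j \in s by apply: (mem_nth set0 (ltn_ord j)).
  have /set_mem [T [A [e [mA AU _ E]]]] := FD _ jF.
  by exists (T, A, e); split=> //; rewrite U01_itv.
have [TAe hT] := choice sN.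
exists n, (fun j => (TAe j).1.1), (fun j => (TAe j).1.2), (fun j => (TAe j).2); split.
- by move=> j; case: (hT j).
- by move=> j; case: (hT j).
- move=> j; have [_ _ <-] := hT j; change (B S) in BS; rewrite -FB in BS; apply: BS.
  by rewrite /= (mem_nth set0 (ltn_ord j)).
- move=> S' hS'; exists B => //; change (B S'); rewrite -FB => N /= NF.
  have jn : (index N s < n)%N by rewrite index_mem.
  have := hS' (Ordinal jn); have [_ _ <-] := hT (Ordinal jn).
  by rewrite /= nth_index.
Qed.

(** The bound is half of the one wanted, to leave room for a perturbation. *)
Definition spread N n : set (autom R) :=
  [set S | forall w, vol (code_ball (autom_fun S) w n) * n.+1%:R <= (2 * N.+1%:R)^-1].

(* Small enough for [vol_code_ball_perturb] to lose only 1 / (4 (N + 1) (n + 1)). *)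
Definition tol N n : R := (4 * N.+1%:R * n.+1%:R ^+ 3)^-1.

(** Each neighbourhood tests only the first [n] preimages of the half interval, hence is open. *)
Definition spread_nbhs N : set (autom R) :=
  \bigcup_(n in setT) \bigcup_(S in spread N n)
    \bigcap_(t in `I_n) weak_nbhs S (half_pre (autom_fun S) t.+1) (tol N n).

Lemma tol_gt0 N n : 0 < tol N n.
Proof. by rewrite invr_gt0 !mulr_gt0// exprn_gt0. Qed.

Lemma half_pre_meas S t : measurable (half_pre (autom_fun S) t).
Proof.
have := meas01_iter (is_autom_fun S) t (@meas01_half R).
rewrite /meas01 => h.
suff -> : half_pre (autom_fun S) t = U01 `&` (iter t (autom_fun S) @^-1` [set x | x <
  2^-1] `&` I01).
  by apply: measurableI => //; exact: measurable_U01.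
by apply/seteqP; split=> x [Ux]; [split=> //; split=> //; exact: U01I|case].
Qed.

Lemma open_spread_nbhs N : open (spread_nbhs N).
Proof.
apply: bigcup_open => n _; apply: bigcup_open => S _.
have h t : open (weak_nbhs S (half_pre (autom_fun S) t.+1) (tol N n)).
  by apply: open_weak_nbhs; [exact: half_pre_meas|move=> x []|exact: tol_gt0].
rewrite bigcap_mkord; elim/big_ind: _ => [|X Y|t _]; [exact: openT|exact: openI|exact: h].
Qed.

Lemma vol_spread_nbhs N S : spread_nbhs N S ->
  exists n, forall w, vol (code_ball (autom_fun S) w n) * n.+1%:R < N.+1%:R^-1.
Proof.
move=> [n _ [T Tn TS]]; exists n => w.
have h : vol (code_ball (autom_fun S) w n) <=
    vol (code_ball (autom_fun T) w n) + n%:R * (n%:R * tol N n).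
  apply: vol_code_ball_perturb; [exact: is_autom_fun|exact: is_autom_fun|].
  move=> t tn; apply/ltW/weak_nbhsE; [exact: half_pre_meas|by move=> x []|].
  exact: TS.
have N0 : 0 < N.+1%:R :> R by [].
have n0 : 0 < n.+1%:R :> R by [].
have nn : n%:R <= n.+1%:R :> R by rewrite ler_nat.
have t0 := tol_gt0 N n.
have e1 : tol N n * n.+1%:R ^+ 3 = (4 * N.+1%:R)^-1.
  by rewrite /tol; field; rewrite !gt_eqF.
(* The loss times the factor [n + 1] is cubic in [n + 1], whence the exponent 3 in [tol]. *)
have e2 : n%:R * (n%:R * tol N n) * n.+1%:R <= (4 * N.+1%:R)^-1.
  rewrite -e1 (_ : tol N n * _ = n.+1%:R * (n.+1%:R * tol N n) * n.+1%:R); last by ring.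
  by rewrite ler_pM2r// ler_pM ?mulr_ge0 ?(ltW t0)// ler_pM2r.
have e3 : (2 * N.+1%:R)^-1 + (4 * N.+1%:R)^-1 = 3 / 4 * N.+1%:R^-1 :> R.
  by field; rewrite !gt_eqF.
have Ni : 0 < N.+1%:R^-1 :> R by rewrite invr_gt0.
have e4 := Tn w.
apply: (@le_lt_trans _ _ ((2 * N.+1%:R)^-1 + (4 * N.+1%:R)^-1)); last first.
  by rewrite e3 gtr_pMl//; lra.
by apply: le_trans (lerD e4 e2); rewrite -mulrDl ler_pM2r.
Qed.

Lemma spread_nbhs_self N n S : spread N n S -> spread_nbhs N S.
Proof.
move=> Sn; exists n => //; exists S => // t _; apply/weak_nbhsE.
- exact: half_pre_meas.
- by move=> x [].
by rewrite (_ : _ `+` _ = set0) ?vol0 ?tol_gt0// /setY setDv setU0.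
Qed.

(** The approximating step map has small balls for every bound, so its class belongs to all the
    [spread_nbhs N] simultaneously. *)
Lemma dense_spread : dense (\bigcap_N spread_nbhs N).
Proof.
move=> O [S OS] oO; have [n [T [A [e [mA AU TS OT]]]]] := open_weak_nbhsP oO OS.
have AI j : A j `<=` I01 by move=> x /AU /U01I.
have mA' j : meas01 (A j) by exact: meas01W.
have im (U : autom R) j : meas01 (autom_fun U @` A j).
  by apply: meas01W; apply: meas01_image => //; exact: is_autom_fun.
(* The room that [S] leaves in each of the finitely many subbasic neighbourhoods; their minimum is
   the precision required of [g]. *)
pose gap j := e j - vol (autom_fun S @` A j `+` autom_fun (T j) @` A j).
have gap0 j : 0 < gap j by rewrite subr_gt0; apply/weak_nbhsE.
pose d := \big[Num.min/1]_(j < n) gap j.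
have d0 : 0 < d by rewrite /d; elim/big_ind: _ => // x y x0 y0; rewrite lt_min x0.
have dgap j : d <= gap j by apply: bigmin_le_cond.
have [g [ag gS gB]] := autom_density (is_autom_fun S) mA AU d0.
pose G := \pi_(autom R) (Preautom ag).
have Gg : autom_fun G = g %[ae leb_on `[0, 1]] := autom_fun_pi (Preautom ag).
have aG := is_autom_fun G.
have vG X : meas01 X -> X `<=` I01 -> vol (autom_fun G @` X `+` g @` X) = 0.
  by move=> mX XI; rewrite volY_sym; apply: vol_image_ae.
exists G; split.
  apply: OT => j; apply/weak_nbhsE => //.
  have mg : meas01 (g @` A j) by apply: meas01W; exact: meas01_image.
  have t1 := volY_triangle (im G j) mg (im (T j) j).
  have t2 := volY_triangle mg (im S j) (im (T j) j).
  have := vG _ (mA' j) (AI j); have := gS j; have := dgap j; rewrite /gap.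
  move: t1 t2; lra.
move=> N _; have N0 : 0 < (2 * N.+1%:R)^-1 :> R by rewrite invr_gt0.
have [n' hn'] := gB _ N0.
apply: (@spread_nbhs_self N n') => w; apply: le_trans (hn' w).
(* The chosen representative of [G] is only almost everywhere equal to [g]; a perturbation of size 0
   carries the bound over to it. *)
rewrite ler_pM2r//; apply: le_trans (vol_code_ball_perturb w ag aG (d := 0) _) _.
  move=> t _; rewrite vG//.
    apply: meas01I; first by apply: meas01W; exact: measurable_U01.
    exact: (meas01_iter ag t.+1 (@meas01_half R)).
  by move=> x [/U01I].
by rewrite !mulr0 addr0.
Qed.

End topology.

(** * Interval exchanges *)

Section iet.
Variable R : realType.
Implicit Types (x y z u v c : R) (T : R -> R).

(** Pieces are left-closed and right-open, so only an endpoint in (u, v] can separate [u] from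
    [v]. *)
Lemma path_piece a u v (s : seq R) : path <%R a s -> a <= u -> u <= v -> v < last a s ->
  (forall c, c \in s -> ~~ (u < c <= v)) ->
  exists k, [/\ (k < size s)%N, nth 0 (a :: s) k <= u & v < nth 0 (a :: s) k.+1].
Proof.
elim: s a => [|c s IHs] a /=; first by move=> _ au uv va;
  have := le_lt_trans (le_trans au uv) va; rewrite ltxx.
move=> /andP[ac cs] au uv vs hs.
have [vc|cv] := ltP v c; first by exists 0%N.
have cu : c <= u by have := hs c (mem_head _ _); rewrite cv andbT -leNgt.
have [|k [ks h1 h2]] := IHs c cs cu uv vs; last by exists k.+1.
by move=> d ds; apply: hs; rewrite in_cons ds orbT.
Qed.

Lemma cell_eq (N : nat) u v : (0 < N)%N -> 0 <= u -> u <= v -> v < 1 ->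
  (forall k, (k < N)%N -> ~~ (u < k%:R / N%:R <= v)) -> cell N u = cell N v.
Proof.
move=> N0 u0 uv v1 h; have N0' : 0 < N%:R :> R by rewrite ltr0n.
have v0 := le_trans u0 uv.
have : cell N v == cell N v by [].
rewrite {1}cellP// => /andP[h1 h2].
have kN : (cell N v < N)%N by apply: cell_lt; rewrite ?v0.
apply/eqP; rewrite cellP//; apply/andP; split; last exact: le_lt_trans h2.
by have := h _ kN; rewrite h1 andbT -leNgt.
Qed.

(** On a piece, a nondecreasing isometry is a translation. *)
Lemma iet_translation T : is_iet T -> exists s : seq R, forall u v,
  U01 u -> U01 v -> u <= v -> (forall c, c \in s -> ~~ (u < c <= v)) ->
  forall c, u <= c <= v -> T c = T u + (c - u).
Proof.
move=> [_ [s [ps /eqP ls] Ts]];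
  exists s => u v /andP[u0 u1] /andP[v0 v1] uv hs c /andP[uc cv].
have [|k [ks h1 h2]] := path_piece ps u0 uv _ hs; first by rewrite ls.
have [Tle Tiso] := Ts k ks.
have uJ : u \in `[nth 0 (0 :: s) k, nth 0 (0 ::
  s) k.+1[ by rewrite in_itv /= h1 (le_lt_trans uv).
have cJ : c \in `[nth 0 (0 :: s) k, nth 0 (0 :: s) k.+1[.
  by rewrite in_itv /= (le_trans h1)// (le_lt_trans cv).
have := Tiso u c uJ cJ; have := Tle u c uJ cJ uc.
by move=> h; rewrite distrC [RHS]distrC !ger0_norm ?subr_ge0// => <-; ring.
Qed.

(** The separating points are the preimages, under fewer than [n] iterations, of the breakpoints of
    [T] and of the ends of the cells. If none of them separates [x] from [y], each iterate up to
    time [n] translates the whole interval between them. *)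
Lemma iet_itinerary T (N : nat) : is_iet T -> (0 < N)%N -> exists L, forall n,
  exists2 ds : seq R, size ds = (n * L)%N &
  forall x y, U01 x -> U01 y -> (forall d, d \in ds -> (d <= x) = (d <= y)) ->
  forall t, (t < n)%N -> cell N (iter t T x) = cell N (iter t T y).
Proof.
move=> iT N0; have [s Ts] := iet_translation iT.
have [[Tin Tinj _] _] := iT; rewrite -U01_itv in Tin Tinj.
have itin t x : U01 x -> U01 (iter t T x).
  by move=> Ux; elim: t => //= t; exact: Tin.
have itinj t x y : U01 x -> U01 y -> iter t T x = iter t T y -> x = y.
  move=> Ux Uy; elim: t => //= t IHt e; apply: IHt.
  by apply: Tinj => //; apply/mem_set; exact: itin.
pose D := s ++ [seq k%:R / N%:R | k <- iota 0 N].
exists (size D) => n.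
(* The preimage of [d] under the [t]-th iterate, unique by injectivity; where there is none, the
   default 0 separates no two points of [0, 1). *)
pose g (t : nat) (d : R) := xget 0 [set z | U01 z /\ iter t T z = d].
exists [seq g t d | t <- iota 0 n, d <- D]; first by rewrite size_allpairs size_iota.
suff main x y : U01 x -> U01 y -> x <= y ->
    (forall d, d \in [seq g t d | t <- iota 0 n, d <- D] -> (d <= x) = (d <= y)) ->
    forall t, (t < n)%N -> cell N (iter t T x) = cell N (iter t T y).
  move=> x y Ux Uy h t tn; have [xy|/ltW yx] := leP x y; first exact: main.
  by apply/esym; apply: main => // d dd; rewrite h.
move=> Ux Uy xy hd.
(* While the [t]-th iterate translates [x, y], a point of [D] between the images would come from
   some [z] in (x, y], and [z] would be in the list. *)
have noD t d : (t < n)%N -> d \in D ->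
    (forall z, x <= z <= y -> iter t T z = iter t T x + (z - x)) ->
    ~~ (iter t T x < d <= iter t T y).
  move=> tn dD ht; apply/negP => /andP[d1 d2].
  pose z := x + (d - iter t T x).
  have ey : iter t T y = iter t T x + (y - x) by apply: ht; rewrite xy lexx.
  have xz : x < z by rewrite /z ltrDl subr_gt0.
  have zy : z <= y by rewrite /z; move: d2; rewrite ey; lra.
  have Uz : U01 z.
    by case/andP: Ux => x0 _; case/andP: Uy => _ y1;
      rewrite /U01 /= (le_trans x0 (ltW xz)) (le_lt_trans zy).
  have Tz : iter t T z = d by rewrite ht ?(ltW xz)// /z; ring.
  have gz : g t d = z.
    have [Ug Tg] : [set z | U01 z /\ iter t T z = d] (g t d) by apply:
      (@xgetPex _ 0 [set z | U01 z /\ iter t T z = d]); exists z.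
    by apply: (itinj t) => //; rewrite Tg.
  have zds : z \in [seq g t d | t <- iota 0 n, d <- D].
    by rewrite -gz; apply: allpairs_f => //; rewrite mem_iota.
  by have := hd z zds; rewrite zy leNgt xz.
have tr t : (t <= n)%N -> forall z, x <= z <= y -> iter t T z = iter t T x + (z - x).
  elim: t => [_ z _|t IHt tn z /andP[xz zy]] /=; first by ring.
  have ht := IHt (ltnW tn).
  have ez : iter t T z = iter t T x + (z - x) by apply: ht; rewrite xz.
  have ey : iter t T y = iter t T x + (y - x) by apply: ht; rewrite xy lexx.
  rewrite (Ts (iter t T x) (iter t T y)); [|exact: itin|exact: itin|by rewrite ey;
    lra| |by rewrite ez ey; lra].
    by rewrite ez; ring.
  by move=> c cs; apply: noD => //; rewrite mem_cat cs.
move=> t tn; have ht := tr t (ltnW tn).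
have ey : iter t T y = iter t T x + (y - x) by apply: ht; rewrite xy lexx.
have /andP[a0 a1] := itin t x Ux; have /andP[b0 b1] := itin t y Uy.
apply: cell_eq => //; first by rewrite ey; lra.
move=> k kN; apply: noD => //; rewrite mem_cat; apply/orP; right.
by apply/mapP; exists k; rewrite // mem_iota.
Qed.

End iet.

(** * Finite labellings and the number of errors along an orbit *)

Section labels.
Variables (R : realType) (n : nat).

Lemma vol_finlabel (J : finType) (f : R -> J) (P : pred J) :
  (forall j, meas01 (f @^-1` [set j])) ->
  meas01 [set x | P (f x)] /\
  vol [set x | P (f x)] = \sum_(j | P j) vol (f @^-1` [set j]).
Proof.
move=> mf; have [|] := @vol_label_pred R J f setT P.
  by move=> j; rewrite setTI.
rewrite (_ : [set x | setT x /\ P (f x)] = [set x | P (f x)]).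
  by under eq_bigr do rewrite setTI.
by apply/seteqP; split=> x /=; [case|split].
Qed.

(** Markov's inequality for the number of [t] with [F t x], whose integral is at most [n * e]. It is
    proved by summing over the finitely many patterns of errors. *)
Lemma vol_markov (F : 'I_n -> set R) (e : R) : (forall t, meas01 (F t)) ->
  (forall t, vol (F t) <= e) ->
  meas01 [set x | (n < 8 * \sum_(t < n) `[< F t x >])%N] /\
  vol [set x | (n < 8 * \sum_(t < n) `[< F t x >])%N] * n%:R <= 8 * n%:R * e.
Proof.
move=> mF eF; pose f x := [ffun t : 'I_n => `[< F t x >]].
have mf j : meas01 (f @^-1` [set j]).
  apply: meas01_ext (meas01_atom (fun t => j t) mF) => x _ /=; split=> h.
    by apply/ffunP => t; rewrite ffunE; apply/asboolP/idP => /h.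
  by move=> t; rewrite -h ffunE; split => /asboolP.
pose P (j : {ffun 'I_n -> bool}) := (n < 8 * \sum_(t < n) j t)%N.
have PE : [set x | (n < 8 * \sum_(t < n) `[< F t x >])%N] = [set x | P (f x)].
  have PfE x : P (f x) = (n < 8 * \sum_(t < n) `[< F t x >])%N.
    by rewrite /P; congr (_ < 8 * _)%N; apply: eq_bigr => t _; rewrite ffunE.
  by apply/seteqP; split=> x /=; rewrite PfE.
rewrite PE; have [mP ->] := vol_finlabel P mf; split=> //.
have eFt t : vol (F t) = \sum_(j : {ffun 'I_n -> bool} | j t) vol (f @^-1` [set j]).
  have [_ <-] := vol_finlabel (fun j : {ffun 'I_n -> bool} => j t) mf.
  by apply: vol_ext => x _; rewrite /f /= ffunE; split=> /asboolP.
have s1 : \sum_(t < n) vol (F t) <= n%:R * e.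
  apply: (@le_trans _ _ (\sum_(t < n) e)); first by apply: ler_sum => t _.
  by rewrite sumr_const card_ord mulr_natl.
rewrite -mulrA; apply: le_trans (_ : _ <= 8 * \sum_(t < n) vol (F t)) _;
  last by rewrite ler_pM2l.
under [in leRHS]eq_bigr do rewrite eFt big_mkcond.
rewrite exchange_big /= mulr_suml mulr_sumr big_mkcond /=.
apply: ler_sum => j _; have vj := vol_ge0 (f @^-1` [set j]).
have -> : \sum_(t < n) (if j t then vol (f @^-1` [set j]) else 0) =
    (\sum_(t < n) j t)%N%:R * vol (f @^-1` [set j]).
  by rewrite natr_sum mulr_suml; apply: eq_bigr => t _; case: (j t); rewrite ?mul1r ?mul0r.
case: ifP => [Pj|_]; last by rewrite !mulr_ge0.
by rewrite mulrC mulrA ler_wpM2r// -natrM ler_nat ltnW.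
Qed.

End labels.

(** * Large code balls for transformations isomorphic to an interval exchange *)

Section iso.
Variables (R : realType) (S T phi psi : R -> R).
Hypothesis aS : is_autom S.
Hypothesis iT : is_iet T.
Hypothesis mphi : measurable_fun setT (phi : measurableTypeR R -> measurableTypeR R).
Hypothesis mpsi : measurable_fun setT (psi : measurableTypeR R -> measurableTypeR R).
Hypothesis phi_pres : forall B, measurable B ->
  pushforward (leb_on `[0, 1]) phi B = leb_on `[0, 1[ B :> \bar R.
Hypothesis phiK : {ae leb_on `[0, 1], forall x : R, psi (phi x) = x}.
Hypothesis semi_conj : {ae leb_on `[0, 1[, forall y : R, T y = phi (S (psi y))}.

Lemma meas01_phi (B : set R) : measurable B -> meas01 (phi @^-1` B).
Proof.
move=> mB; apply: meas01W; rewrite -[X in measurable X]setTI.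
exact: (mphi measurableT).
Qed.

Lemma vol_phi (B : set R) : measurable B -> vol (phi @^-1` B) = vol B.
Proof.
move=> mB; rewrite [RHS]vol_U01; last exact: meas01W.
have := congr1 fine (phi_pres mB); rewrite -[LHS]/(vol (phi @^-1` B)) => ->.
rewrite [LHS]/(fine (lebesgue_measure (B `&` [set` `[0, 1[]))) -U01_itv setIC.
by rewrite lebesgue_vol//; [apply: measurableI => //;
  exact: measurable_U01|move=> x [/U01I]].
Qed.

(** One null set collects the points where [psi] fails to undo [phi], those sent by [phi] into the
    null set where the conjugacy fails, and those sent outside [0, 1). *)
Lemma iso_exceptional : exists N : set R, [/\ measurable N, vol N = 0 &
  forall x, I01 x -> ~ N x -> [/\ psi (phi x) = x, U01 (phi x) & T (phi x) = phi (S x)]].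
Proof.
have [N1 [mN1 vN1 hN1]] := phiK; have [N2 [mN2 vN2 hN2]] := semi_conj.
have mN2' : measurable (phi @^-1` N2).
  by rewrite -[X in measurable X]setTI; exact: (mphi measurableT).
have mU : measurable (phi @^-1` ~` U01).
  rewrite -[X in measurable X]setTI; apply: (mphi measurableT).
  by apply: measurableC; exact: measurable_U01.
exists (N1 `|` (phi @^-1` N2 `|` phi @^-1` ~` U01)); split.
- by apply: measurableU => //; exact: measurableU.
- have v1 : vol N1 = 0 by rewrite /vol vN1.
  have v2 : vol (phi @^-1` N2) = 0.
    rewrite vol_phi// vol_U01; last exact: meas01W.
    rewrite /vol leb_onE (_ : U01 `&` N2 `&` I01 = N2 `&` [set` `[0, 1[]);
      first by rewrite [X in fine X]vN2.
    by rewrite -U01_itv; apply/seteqP; split=> x [] => [[Ux Nx] _|Nx Ux]; split=> //;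
      exact: U01I.
  have v3 : vol (phi @^-1` ~` U01) = 0.
    rewrite vol_phi; last by apply: measurableC; exact: measurable_U01.
    rewrite vol_U01; first by rewrite setICr vol0.
    by apply: meas01W; apply: measurableC; exact: measurable_U01.
  have m1 := meas01W mN1; have m2 := meas01W mN2'; have m3 := meas01W mU.
  have m23 := meas01U m2 m3; have m123 := meas01U m1 m23.
  apply/eqP; rewrite eq_le vol_ge0 andbT.
  apply: (@le_trans _ _ (vol N1 + (vol (phi @^-1` N2) + vol (phi @^-1` ~` U01))));
    last first.
    by rewrite v1 v2 v3 !addr0.
  apply: (@le_trans _ _ (vol N1 + vol (phi @^-1` N2 `|` phi @^-1` ~` U01))).
    exact: vol_leU.
  by rewrite lerD2l; exact: vol_leU.
- move=> x Ix nN; have h1 : psi (phi x) = x.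
    by apply: contrapT => h; apply: nN; left; apply: hN1.
  split=> //.
    by apply: contrapT => h; apply: nN; right; right.
  rewrite -{2}h1; apply: contrapT => h; apply: nN; right; left; exact: hN2.
Qed.

(** Transported to the interval exchange, the code is up to few errors an itinerary through cells.
    Such itineraries of length [n] are determined by the position among [O(n)] points, and by
    pigeonhole one position has measure of order [1 / n]. *)
Lemma iso_big_ball : exists L, forall n, exists w : nat -> bool,
  1 <= vol (code_ball S w n) * (L * n.+1)%:R.
Proof.
have [N [mN vN hN]] := iso_exceptional.
have mhalf : measurable [set x : R | x < 2^-1].
  rewrite (_ : mkset _ = [set` `]-oo, 2^-1[]); first exact: measurable_itv.
  by apply/seteqP; split=> x /=; rewrite in_itv.
pose A' := U01 `&` psi @^-1` [set x | x < 2^-1].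
have mA' : measurable A'.
  apply: measurableI; first exact: measurable_U01.
  by rewrite -[X in measurable X]setTI; exact: (mpsi measurableT).
have AI : A' `<=` I01 by move=> x [/U01I].
(* The average proportion of errors is at most 1/16, so by Markov's inequality more than 1/8 of the
   letters are wrong on at most half of the space. *)
have e16 : 0 < 16^-1 :> R by rewrite invr_gt0 ltr0n.
have [M hM] := approx_cells mA' AI e16.
have [V hV] := hM M.+1 (leqnSn M).
pose C : set R := cells M.+1 V.
have mC : measurable C.
  have := meas01_cells (R := R) V (ltn0Sn M); rewrite /meas01.
  suff -> : cells M.+1 V `&` I01 = C by [].
  by apply/seteqP; split=> x; [case|move=> Cx; split=> //; case: Cx => /U01I].
(* The points whose letter is predicted wrongly by the cell of their image under [phi]. *)
pose E := [set x | x < 2^-1] `+` phi @^-1` C.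
have mE : meas01 E by apply: meas01Y; [exact: meas01_half|exact: meas01_phi].
have vE : vol E <= 16^-1.
  apply: le_trans hV; have mAC : measurable (A' `+` C) by apply: measurableU;
    exact: measurableD.
  rewrite -(vol_phi mAC) -[leRHS]addr0 -vN.
  apply: vol_leU => //; [exact: meas01_phi|exact: meas01W|].
  move=> x Ix Ex; have [Nx|nNx] := pselect (N x); [by right|left].
  have [pp Up _] := hN x Ix nNx.
  have e : A' (phi x) <-> x < 2^-1 by rewrite /A' /= pp; split=> [[]//|]; by split.
  by case: Ex => -[h1 h2]; [left; split=> //; exact/e|right; split=> // /e].
have [L0 hL0] := iet_itinerary iT (ltn0Sn M).
exists (2 * L0.+1)%N => n.
have [ds sds hds] := hL0 n.
pose m := size ds.
pose F (t : 'I_n) := iter t S @^-1` E.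
have mF t : meas01 (F t) by exact: meas01_iter.
have vF t : vol (F t) <= 16^-1 by rewrite (vol_iter aS).
have [mX vX] := vol_markov mF vF.
set X := [set x | _] in mX vX.
have vXc : 2^-1 <= vol (~` X).
  have X2 : vol X <= 2^-1.
    have [n0|n0] := eqVneq n 0%N.
      rewrite (_ : X = set0) ?vol0//; apply/seteqP; split=> // x; rewrite /X /=.
      by rewrite big1 ?muln0// => t; have := ltn_ord t; rewrite [X in (_ < X)%N]n0.
    have np : 0 < n%:R :> R by rewrite ltr0n lt0n.
    by rewrite -(ler_pM2r np); apply: le_trans vX _; lra.
  have : vol setT <= vol X + vol (~` X).
    apply: vol_leU => //; [apply: meas01W; exact: measurableT|exact: meas01C|].
    by move=> x _ _; have [] := pselect (X x); [left|right].
  by rewrite volT; lra.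
pose Z (j : 'I_m) := phi @^-1` [set y | nth 0 ds j <= y].
have mZ j : meas01 (Z j).
  apply: meas01_phi; rewrite (_ : mkset _ = [set` `[nth 0 ds j, +oo[]);
    first exact: measurable_itv.
  by apply/seteqP; split=> x /=; rewrite in_itv /= andbT.
pose lab x := [ffun j : 'I_m => (nth 0 ds j <= phi x)%R].
have mlab v : meas01 (lab @^-1` [set v]).
  apply: meas01_ext (meas01_atom (fun t => v t) mZ) => x _ /=; split=> h.
    by apply/ffunP => t; rewrite ffunE; apply/idP/idP => /h.
  by move=> t; rewrite -h ffunE.
(* The number of points of [ds] at or below [phi x]. The half-lines above these points are nested,
   so this number determines the whole label, leaving [m + 1] classes. *)
pose rk (v : {ffun 'I_m -> bool}) := (\sum_(j < m) v j)%N.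
have rk_le v : (rk v <= m)%N.
  apply: (@leq_trans (\sum_(j < m) 1)%N); last by rewrite sum_nat_const card_ord muln1.
  by apply: leq_sum => j _; case: (v j).
pose K (q : 'I_m.+1) := [set x | rk (lab x) == q].
have mK q : meas01 (K q) by case: (vol_finlabel (fun v => rk v == q) mlab).
have mXK q : meas01 (~` X `&` K q) by apply: meas01I => //; exact: meas01C.
have [q hq] : exists q, (2 * m.+1%:R)^-1 <= vol (~` X `&` K q).
  apply: contrapT => /forallNP hlt.
  have h : vol (~` X) <= \sum_(q < m.+1) vol (~` X `&` K q).
    apply: (@vol_sum_le_fin _ _ predT) => //; first exact: meas01C.
    move=> x _ Xx; have rkm : (rk (lab x) < m.+1)%N by exact: rk_le.
    by exists (Ordinal rkm) => //; split; [exact: Xx|exact: eqxx].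
  have : \sum_(q < m.+1) vol (~` X `&` K q) < \sum_(q < m.+1) (2 * m.+1%:R)^-1.
    apply: ltr_sum => [|q _]; first by apply/hasP; exists ord0 => //;
      rewrite mem_index_enum.
    by rewrite ltNge; apply/negP/hlt.
  have e2 : m.+1%:R * (2 * m.+1%:R)^-1 = 2^-1 :> R by field; rewrite !gt_eqF.
  rewrite sumr_const card_ord -[X in _ < X]mulr_natl e2 => h2.
  by have := le_lt_trans (le_trans vXc h) h2; rewrite ltxx.
pose bad := [set x | exists2 t : 'I_n, xpredT t & (iter t S @^-1` N) x].
have mbad : meas01 bad by apply: meas01_ex => t _; apply: meas01_iter => //; exact: meas01W.
have vbad : vol bad = 0.
  apply/eqP; rewrite eq_le vol_ge0 andbT.
  apply: (@le_trans _ _ (\sum_(t < n) vol (iter t S @^-1` N))).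
    apply: (@vol_sum_le_fin _ _ predT) => // t _.
    by apply: meas01_iter => //; exact: meas01W.
  rewrite big1// => t _; rewrite (vol_iter aS)//; exact: meas01W.
have good x : I01 x -> ~ bad x -> forall t, (t < n)%N ->
    U01 (phi (iter t S x)) /\ phi (iter t S x) = iter t T (phi x).
  move=> Ix nb; have nbt t : (t < n)%N -> ~ N (iter t S x).
    by move=> tn Nt; apply: nb; exists (Ordinal tn).
  elim=> [tn|t IHt tn] /=.
    by split=> //; case: (hN _ Ix (nbt 0%N tn)).
  have [_ _ e] := hN _ (autom_iter_in aS t Ix) (nbt t (ltnW tn)).
  have [_ U _] := hN _ (autom_iter_in aS t.+1 Ix) (nbt t.+1 tn).
  by split=> //; rewrite -e (IHt (ltnW tn)).2.
(* A reference point of the large class whose orbit avoids the exceptional set up to time [n]; its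
   predicted letters will be the centre of the ball. *)
have [x0 [Ix0 [Xx0 Kx0] nb0]] : exists x0, [/\ I01 x0, (~` X `&` K q) x0 & ~ bad x0].
  apply: contrapT => h; suff : vol (~` X `&` K q) <= 0.
    by apply/negP; rewrite -ltNge (lt_le_trans _ hq)// invr_gt0 mulr_gt0.
  rewrite -vbad; apply: vol_le => // x Ix XK; apply: contrapT => nb.
  by apply: h; exists x.
have rkE x : (rk (lab x) = \sum_(d <- ds) (d <= phi x)%R)%N.
  rewrite (big_nth 0) big_mkord; apply: eq_bigr => j _.
  by rewrite /lab ffunE.
have same x : U01 (phi x) -> U01 (phi x0) -> K q x ->
    forall d, d \in ds -> (d <= phi x) = (d <= phi x0).
  move=> _ _ /eqP Kx d dd; have := Kx; rewrite -(eqP Kx0) !rkE => {Kx}.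
  have aux (a b : R) : a <= b -> (\sum_(d <- ds) (d <= a)%R = \sum_(d <- ds) (d <=
    b)%R)%N ->
      (d <= a) = (d <= b).
    move=> ab e; apply/idP/idP => [da|db]; first exact: le_trans ab.
    apply: contraT => da; have : (\sum_(d <- ds) (d <= a)%R < \sum_(d <- ds) (d <= b)%R)%N.
      rewrite !(big_rem d dd) /= (negbTE da) db add0n add1n ltnS.
      by apply: leq_sum => c _; case: (boolP (c <= a)%R) => // /le_trans ->.
    by rewrite e ltnn.
  move=> e; have [le|/ltW le] := leP (phi x) (phi x0); first exact: aux.
  by apply/esym/aux.
pose w t : bool := V (cell M.+1 (iter t T (phi x0))).
exists w.
(* Points of the same class have the same itinerary as [x0], hence the same predicted letters, and
   outside [X] at most [n / 8] of these are wrong. *)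
have sub : vol (~` X `&` K q) <= vol (code_ball S w n) + vol bad.
  apply: vol_leU => //; first exact: meas01_code_ball.
  move=> x Ix [Xx Kx]; have [bx|nbx] := pselect (bad x); [by right|left].
  have gx := good x Ix nbx; have g0 := good x0 Ix0 nb0.
  rewrite /code_ball /= leqNgt; apply/negP => h; apply: Xx; rewrite /X /=.
  apply: leq_trans h _; rewrite leq_mul2l /= /code_miss; apply: leq_sum => t _.
  have n0 : (0 < n)%N by exact: leq_ltn_trans (ltn_ord t).
  have Ux := (gx 0%N n0).1; have U0 := (g0 0%N n0).1; rewrite /= in Ux U0.
  have ct := hds _ _ Ux U0 (same x Ux U0 Kx) t (ltn_ord t).
  have [Ut et] := gx t (ltn_ord t).
  case: asboolP => [_|nF]; first by case: (_ != _).
  suff : (iter t S x < 2^-1)%R = w t by move=> ->; rewrite eqxx.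
  rewrite /w -ct -et.
  apply: contrapT => h; apply: nF; rewrite /F /E /setY /= /C /cells /=.
  case hh : (_ < _) h; case hv : (V _) => // _.
    by left; split=> // -[].
  by right; split=> // -[].
rewrite vbad addr0 in sub.
have mp : 0 < 2 * m.+1%:R :> R by rewrite mulr_gt0.
have h1 : 1 <= vol (code_ball S w n) * (2 * m.+1%:R).
  by rewrite -ler_pdivrMr// mul1r; exact: le_trans hq sub.
apply: le_trans h1 _; rewrite ler_wpM2l ?vol_ge0// -natrM ler_nat.
by rewrite -mulnA leq_mul2l /= /m sds; lia.
Qed.

End iso.

Theorem theorem1p1 (R : realType) :
  exists G : set (autom R),
    [/\ Gdelta G, dense G &
        G `<=` [set S | ~ exists T : R -> R, is_iet T /\
          isomorphic (leb_on `[0, 1]) (leb_on `[0, 1[) (autom_fun S) T]].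
Proof.
exists (\bigcap_N (@spread_nbhs R N)); split; last first.
- move=> S GS [T [iT [phi [psi [[mphi mpsi] pres phiK _ conj]]]]].
  have [L hL] := iso_big_ball (is_autom_fun S) iT mphi mpsi pres phiK conj.
  (* Membership for the index [N = L] bounds every ball below [1 / ((L + 1) * (n + 1))], while some
     ball has measure at least [1 / (L * (n + 1))]. *)
  have [n hn] := vol_spread_nbhs (GS L I).
  have [w hw] := hL n; have := hn w; rewrite ltNge => /negP; apply.
  rewrite -[_^-1]mul1r ler_pdivrMr//; apply: le_trans hw _.
  rewrite natrM mulrCA mulrC ler_wpM2l ?mulr_ge0 ?vol_ge0//.
  by rewrite ler_nat.
- exact: dense_spread.
- by exists (@spread_nbhs R) => // N; exact: open_spread_nbhs.
Qed.
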